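(* Let a finite group $G$ be the product of mutually permutable subgroups $A$ and $B$. Then $\max\{h^*(A),h^*(B)\}\le h^*(G)\le\max\{h^*(A),h^*(B)\}+1$.
   Context: $G=AB$ is a mutually permutable product of $A$ and $B$ if $A$ permutes with every subgroup of $B$ and $B$ permutes with every subgroup of $A$. $h^*(G)$ is the generalized Fitting height: with $\mathrm{F}^*$ the generalized Fitting subgroup, set $\mathrm{F}^*_{(0)}(G)=1$ and let $\mathrm{F}^*_{(i+1)}(G)$ be the full preimage of $\mathrm{F}^*(G/\mathrm{F}^*_{(i)}(G))$; $h^*(G)$ is the least $h$ with $\mathrm{F}^*_{(h)}(G)=G$. *)

(* Defs.v *)
From mathcomp Require Import all_boot all_fingroup all_solvable.
Set Implicit Arguments. Unset Strict Implicit. Unset Printing Implicit Defensive.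
Local Open Scope group_scope.


Definition quasisimple (gT : finGroupType) (H : {set gT}) : bool :=
  ([~: H, H] == H) && simple (H / 'Z(H)).

Definition component (gT : finGroupType) (H G : {set gT}) : bool :=
  [&& group_set H, H <|<| G & quasisimple H].

Definition layer (gT : finGroupType) (G : {set gT}) : {set gT} :=
  << \bigcup_(H : {set gT} | component H G) H >>.

Definition Fstar (gT : finGroupType) (G : {set gT}) : {set gT} := 'F(G) <*> layer G.

Fixpoint FstarSeries (gT : finGroupType) (n : nat) (G : {set gT}) : {set gT} :=
  match n with
  | 0 => 1
  | n'.+1 => coset (FstarSeries n' G) @*^-1 Fstar (G / FstarSeries n' G)
  end.

(* h*(G): least h with F*_(h)(G) = G.  Such an h is always <= #|G|, since
   the series strictly increases until it reaches G. *)
Definition hstar (gT : finGroupType) (G : {set gT}) : nat :=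
  find (fun n => FstarSeries n G == G) (iota 0 #|G|.+1).


Definition mutually_permutable (gT : finGroupType) (A B : {group gT}) : Prop :=
  (forall H : {group gT}, H \subset B -> A * H = H * A) /\
  (forall K : {group gT}, K \subset A -> B * K = K * B).

(* Main.v *)
Require Import Defs.
From mathcomp Require Import all_boot all_fingroup all_solvable.

(* Write X' for the derived subgroup, F* for the generalized Fitting subgroup and E for the layer.
   The key point is that A' and B' are subnormal in G. It is proved by induction through a minimal
   normal subgroup N: the product (A :&: N)(B :&: N) is normal in G, so it is 1 or N, and in both cases A :&: N is
   normal in N (if N is nonabelian by induction and Ito's theorem, and for simple N by a direct
   argument). Modulo A :&: N, for each prime q a Sylow q-subgroup S of B :&: AN yields an
   A-invariant Sylow q-subgroup AS :&: N of N on which A' acts as a q-group, and this makes A'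
   subnormal in A'N.

   Lower bound: subnormality of A' gives A :&: F*(G) <= F*(A), also in every quotient, hence
   A :&: F*_(n)(G) <= F*_(n)(A) for all n.

   Upper bound: subnormality of A' also gives [F*(A), A] <= F*(G), so the image of F*(A) in G / F*(G)
   is central in the image of A, and induction reduces the claim to quasinilpotent A and B. In that
   case G' <= F*(G): every component of G lies in A or in B, which shows G' <= E(G) C_G(E(G)),
   and G' centralizes every abelian chief factor of G. *)

Set Implicit Arguments.
Unset Strict Implicit.
Unset Printing Implicit Defensive.

Local Open Scope group_scope.

(** * Components and the generalized Fitting subgroup *)

(** A factor itself need not be subnormal: in S_3 = C_3 C_2 the factor C_2 is not, and this product
    attains the upper bound. The argument only reaches A' because it works with A-invariant sections
    of prime order, on which A acts as an abelian group. All of them come from one device: if A :&: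
    N = 1 and A permutes with the subgroups of B, a subgroup H of B inside AN leaves on N the
    A-invariant trace AH :&: N, of order |H : H :&: A|. A maximal chain of a q-group H then becomes
    a chain in N with indices 1 or q. This count is the reason for factoring out A :&: N.

    For quasinilpotent A and B and an abelian chief factor N of exponent p, the same chains and
    |Aut(C_p)| = p - 1 show that only primes q <= p divide |G / C_G(N)|. The prime p is excluded
    too: O_p(G / C_G(N)) = 1, while a mutually permutable product of abelian groups has a nontrivial
    O_p for its largest prime divisor p.

    Heights of different groups are compared by making F* a functor and factoring one morphism
    through another. *)

Section Quasisimple.

Variable gT : finGroupType.
Implicit Types (G H K L M S : {group gT}).

Lemma quasisimple_perfect L : quasisimple L -> [~: L, L] = L.
Proof. by case/andP=> /eqP. Qed.

Lemma perfect_solvable G : [~: G, G] = G -> solvable G -> G :=: 1.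
Proof.
move=> perfG solG; apply/eqP; apply: contraT => ntG.
by have:= sol_der1_proper solG (subxx G) ntG; rewrite derg1 perfG properxx.
Qed.

Lemma perfect_sub_normal G H :
  [~: G, G] = G -> H <| G -> abelian (G / H) -> H :=: G.
Proof.
move=> perfG /andP[sHG nHG] abGH; apply/eqP.
by rewrite eqEsubset sHG -{1}perfG der1_min.
Qed.

(** Being free of the quotient by the centre, this criterion passes easily to homomorphic images.
    From left to right, a normal [M] outside ['Z(L)] satisfies [M * 'Z(L) = L], so [L / M] is
    abelian and [M = L] by perfectness. *)
Lemma quasisimpleP L :
  reflect [/\ L :!=: 1, [~: L, L] = L &
           forall M, M <| L -> M :=: L \/ M \subset 'Z(L)]
          (quasisimple L).
Proof.
apply: (iffP idP) => [qsL | [ntL perfL maxL]].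
  have perfL := quasisimple_perfect qsL.
  have /simpleP[ntLZ simLZ] : simple (L / 'Z(L)) by case/andP: qsL.
  split=> // [|M nsML].
    by apply: contraNneq ntLZ => L1; rewrite -subG1 quotient_sub1 ?gFnorm //;
       apply: subset_trans (sub1G _); rewrite L1.
  have /andP[sML nML] := nsML.
  have nZM : M \subset 'N('Z(L)) := subset_trans sML (gFnorm _ _).
  have [MZ1|MZL] := simLZ _ (quotient_normal 'Z(L) nsML).
    by right; rewrite -quotient_sub1 // MZ1.
  left; apply: perfect_sub_normal => //.
  have defL : M * 'Z(L) = L.
    rewrite -[RHS](quotientGK (center_normal L)) -MZL quotientK //.
    exact: normC.
  rewrite -{1}defL quotientMl // trivg_quotient mul1g.
  by rewrite quotient_abelian // center_abelian.
have nZ : 'Z(L) <| L := center_normal L.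
apply/andP; split; first by rewrite perfL.
apply/simpleP; split=> [|Mb nsMb].
  rewrite -subG1 quotient_sub1 ?gFnorm //; apply: contra ntL => sLZ.
  apply/eqP/perfect_solvable => //; apply: abelian_sol.
  exact: abelianS sLZ (center_abelian L).
case/(inv_quotientN nZ): nsMb => M defMb sZM nsML; rewrite {}defMb.
have [->|sMZ] := maxL M nsML; first by right.
by left; apply/trivgP; rewrite quotient_sub1 // (subset_trans sMZ) ?normG.
Qed.

Lemma quasisimple_subnormal L S :
  quasisimple L -> S <|<| L -> S :=: L \/ S \subset 'Z(L).
Proof.
move=> qsL snSL; have [_ _ maxL] := quasisimpleP _ qsL.
have [->|[K [snSK nsKL prKL]]] := subnormalEr snSL; [by left | right].
have [defK|] := maxL K nsKL; first by rewrite defK properxx in prKL.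
by apply: subset_trans; apply: subnormal_sub.
Qed.

Lemma quasisimple_nonabelian L : quasisimple L -> ~~ abelian L.
Proof.
case/quasisimpleP=> ntL perfL _; apply: contra ntL => /abelian_sol solL.
exact/eqP/perfect_solvable.
Qed.

End Quasisimple.

Lemma morphim_quasisimple (gT rT : finGroupType) (D L : {group gT})
    (f : {morphism D >-> rT}) :
  L \subset D -> quasisimple L -> f @* L :!=: 1 -> quasisimple (f @* L).
Proof.
move=> sLD /quasisimpleP[_ perfL maxL] ntfL; apply/quasisimpleP; split=> //.
  by rewrite -morphimR // perfL.
move=> M nsM; pose K := (L :&: f @*^-1 M)%G.
have fK : f @* K = M by rewrite /= morphim_setIpre (setIidPr (normal_sub nsM)).
have nsKL : K <| L.
  rewrite /normal subsetIl normsI ?normG //.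
  apply: subset_trans (morphpre_norm f M).
  by rewrite -sub_morphim_pre // normal_norm.
have [defK|sKZ] := maxL K nsKL; first by left; rewrite -fK defK.
right; rewrite -fK; apply: subset_trans (morphimS f sKZ) _.
by rewrite subsetI morphimS ?center_sub // morphim_cents // subsetIr.
Qed.

Section Components.

Variable gT : finGroupType.
Implicit Types (G H K L M N S : {group gT}).

Lemma componentP (X G : {set gT}) :
  component X G -> exists2 L : {group gT}, X = L & L <|<| G /\ quasisimple L.
Proof. by case/and3P=> gX snX qsX; exists (Group gX). Qed.

Lemma componentG L G : component L G = (L <|<| G) && quasisimple L.
Proof. by rewrite /component groupP. Qed.

Lemma component_sub L G : component L G -> L \subset G.
Proof. by rewrite componentG => /andP[/subnormal_sub]. Qed.

Lemma component_sub_layer L G : component L G -> L \subset layer G.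
Proof. by move=> cL; rewrite sub_gen // (bigcup_max (gval L)). Qed.

Lemma component_trans L S G : component L S -> S <|<| G -> component L G.
Proof.
by rewrite !componentG => /andP[snL ->] snS; rewrite (subnormal_trans snL snS).
Qed.

Lemma component_in L S G :
  component L G -> L \subset S -> S \subset G -> component L S.
Proof.
rewrite !componentG => /andP[snL ->] sLS sSG; rewrite andbT.
by have := setI_subnormal sSG snL; rewrite (setIidPl sLS).
Qed.

Lemma componentJ L G x : x \in G -> component L G -> component (L :^ x) G.
Proof.
rewrite componentG => Gx /andP[snL qsL].
have idG : conjgm G x @* G = G by rewrite norm_conjg_im // (subsetP (normG G)).
have sLG := subnormal_sub snL.
have defLx : conjgm G x @* L = L :^ x by rewrite morphim_conj (setIidPr sLG).
have snfL := morphim_subnormal [morphism of conjgm G x] snL.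
rewrite /= idG in snfL.
rewrite -defLx [component _ _]componentG snfL morphim_quasisimple //.
rewrite -subG1 /= defLx sub_conjg conjs1g subG1.
by case/quasisimpleP: qsL.
Qed.

Canonical layer_group (A : {set gT}) := Eval hnf in [group of layer A].

Lemma layer_sub G : layer G \subset G.
Proof.
rewrite gen_subG; apply/bigcupsP=> X /componentP[L -> [/subnormal_sub //]].
Qed.

Lemma layer_subP G (P : {set gT}) : group_set P ->
  (forall L, component L G -> L \subset P) -> layer G \subset P.
Proof.
move=> gP sP; rewrite (gen_subG _ (Group gP)).
by apply/bigcupsP=> X cX; have [L defX _] := componentP cX; rewrite defX sP // -defX.
Qed.

(** Induction into a proper normal [M] containing [L]. If [L] centralizes [N :&: M], which contains
    [[~: L, N]], then [[~: L, N, L] = 1], and the three subgroups lemma with [L] perfect gives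
    [[~: L, N] = 1]. *)
Lemma component_normal L N G :
  component L G -> N <| G -> L \subset N \/ [~: L, N] = 1.
Proof.
have [m] := ubnP #|G|; elim: m G N => // m IHm G N leGm cL nsNG.
have /andP[snL qsL] : (L <|<| G) && quasisimple L by rewrite -componentG.
have [ntL perfL maxL] := quasisimpleP _ qsL.
have [defL|[M [snLM nsMG prMG]]] := subnormalEr snL.
  have nsNL : N <| L by rewrite defL.
  have [->|sNZ] := maxL N nsNL; first by left.
  by right; apply/commG1P; rewrite centsC (subset_trans sNZ) // subsetIr.
have sLM := subnormal_sub snLM; have sMG := normal_sub nsMG.
have cLM := component_in cL sLM sMG.
have nsNM : N :&: M <| M.
  by rewrite /normal subsetIr normsI ?normG // (subset_trans sMG) ?normal_norm.
have ltM : #|M| < m by apply: leq_trans (proper_card prMG) _.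
have [|cLNM] := IHm M (N :&: M)%G ltM cLM nsNM.
  by rewrite subsetI => /andP[sLN _]; left.
have sLN_NM : [~: L, N] \subset N :&: M.
  rewrite subsetI commg_subr (subset_trans (subset_trans sLM sMG)) ?normal_norm //=.
  rewrite (subset_trans (commSg _ sLM)) // commg_subl.
  by rewrite (subset_trans (normal_sub nsNG)) ?normal_norm.
have cLLN : [~: L, N, L] = 1.
  by have := commgS L sLN_NM; rewrite /= cLNM commGC => /trivgP.
right; rewrite -{1}perfL; apply: three_subgroup => //.
by rewrite [[~: N, L]]commGC.
Qed.

Lemma component_subnormal L S G :
  component L G -> S <|<| G -> L \subset S \/ [~: L, S] = 1.
Proof.
have [m] := ubnP #|G|; elim: m G => // m IHm G leGm cL snS.
have [->|[M [snSM nsMG prMG]]] := subnormalEr snS.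
  by left; apply: component_sub.
have [sLM|cLM] := component_normal cL nsMG.
  have cLM := component_in cL sLM (normal_sub nsMG).
  by apply: (IHm M) => //; apply: leq_trans (proper_card prMG) _.
by right; apply/trivgP; rewrite -cLM commgS ?subnormal_sub.
Qed.

Lemma component_eq L1 L2 G :
  component L1 G -> component L2 G -> L1 \subset L2 -> L1 = L2.
Proof.
move=> cL1 cL2 sL12.
have qs L : component L G -> quasisimple L by rewrite componentG => /andP[].
have := component_in cL1 sL12 (component_sub cL2).
rewrite componentG => /andP[snL12 _].
have [defL1|sL1Z] := quasisimple_subnormal (qs _ cL2) snL12; first exact/group_inj.
case/negP: (quasisimple_nonabelian (qs _ cL1)).
exact: abelianS sL1Z (center_abelian _).
Qed.

Lemma component_cents L1 L2 G :
  component L1 G -> component L2 G -> L1 != L2 -> L1 \subset 'C(L2).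
Proof.
move=> cL1 cL2 neqL12.
have snL2 : L2 <|<| G by move: cL2; rewrite componentG => /andP[].
have [sL12|/commG1P//] := component_subnormal cL1 snL2.
by rewrite (component_eq cL1 cL2 sL12) eqxx in neqL12.
Qed.

Lemma component_nonabelian L G : component L G -> ~~ abelian L.
Proof. by rewrite componentG => /andP[_ /quasisimple_nonabelian]. Qed.

Lemma component_perfect L G : component L G -> [~: L, L] = L.
Proof. by rewrite componentG => /andP[_ /quasisimple_perfect]. Qed.

Lemma component_cent_solvable L S G :
  component L G -> S <|<| G -> solvable S -> [~: L, S] = 1.
Proof.
move=> cL snS solS; have [sLS|//] := component_subnormal cL snS.
by rewrite (perfect_solvable (component_perfect cL)) ?comm1G // (solvableS sLS).
Qed.

Lemma layer_cent_solvable S G : S <|<| G -> solvable S -> S \subset 'C(layer G).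
Proof.
move=> snS solS; rewrite centsC; apply: layer_subP => [|L cL]; first exact: groupP.
exact/commG1P/(component_cent_solvable cL).
Qed.

Lemma layer_norm G : G \subset 'N(layer G).
Proof.
apply/subsetP=> x Gx; rewrite inE sub_conjg; apply: layer_subP => [|L cL].
  exact: (groupP (layer G :^ x^-1)%G).
by rewrite -sub_conjg; apply/component_sub_layer/componentJ.
Qed.

Lemma layer_normal G : layer G <| G.
Proof. by rewrite /normal layer_sub layer_norm. Qed.

Lemma layer_subnormalS S G : S <|<| G -> layer S \subset layer G.
Proof.
move=> snS; apply: layer_subP => [|L cL]; first exact: groupP.
exact/component_sub_layer/(component_trans cL).
Qed.

Lemma layer_perfect G : [~: layer G, layer G] = layer G.
Proof.
apply/eqP; rewrite eqEsubset commg_subl normG /=.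
apply: layer_subP => [|L cL]; first exact: groupP.
by rewrite -(component_perfect cL) commgSS ?component_sub_layer.
Qed.

(** Each component of [N] lies in [S] or centralizes [S]; in both cases it normalizes [S]. *)
Lemma subnormal_layer_normal N S : layer N = N -> S <|<| N -> S <| N.
Proof.
move=> layN snS; rewrite /normal subnormal_sub // -layN.
apply: layer_subP => [|L cL]; first exact: groupP.
have [sLS|/commG1P cLS] := component_subnormal cL snS.
  by rewrite (subset_trans sLS) ?normG.
exact: cents_norm.
Qed.

Lemma Fitting_subnormalS S G : S <|<| G -> 'F(S) \subset 'F(G).
Proof.
have [m] := ubnP #|G|; elim: m G => // m IHm G leGm snS.
have [->//|[M [snSM nsMG prMG]]] := subnormalEr snS.
apply: subset_trans (IHm M _ snSM) _.
  by apply: leq_trans (proper_card prMG) _.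
by rewrite Fitting_max ?Fitting_nil // gFnormal_trans.
Qed.

Lemma nilpotent_subnormal_Fitting S G :
  S <|<| G -> nilpotent S -> S \subset 'F(G).
Proof. by move=> snS nilS; rewrite -(nilpotent_Fitting nilS) Fitting_subnormalS. Qed.

Canonical Fstar_group (A : {set gT}) := Eval hnf in [group of Fstar A].

Lemma Fstar_sub G : Fstar G \subset G.
Proof. by rewrite join_subG Fitting_sub layer_sub. Qed.

Lemma Fitting_cent_layer G : 'F(G) \subset 'C(layer G).
Proof.
apply: layer_cent_solvable; first exact/normal_subnormal/Fitting_normal.
exact/nilpotent_sol/Fitting_nil.
Qed.

Lemma FstarE G : Fstar G = 'F(G) * layer G.
Proof. by rewrite /Fstar norm_joinEr // cents_norm // centsC Fitting_cent_layer. Qed.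

Lemma cent_layer_Fstar G : 'C_(Fstar G)(layer G) \subset 'F(G).
Proof.
rewrite FstarE -group_modl ?Fitting_cent_layer // mulG_subG subxx /=.
have nZ : 'Z(layer G) <| G := gFnormal_trans _ (layer_normal G).
exact: Fitting_max nZ (abelian_nil (center_abelian _)).
Qed.

Lemma nilpotent_Fstar G : nilpotent G -> Fstar G = G.
Proof.
move=> nilG; apply/eqP; rewrite eqEsubset Fstar_sub -{1}(nilpotent_Fitting nilG).
exact: joing_subl.
Qed.

Lemma simple_quasisimple L : simple L -> ~~ abelian L -> quasisimple L.
Proof.
move=> /simpleP[ntL simL] abL; apply/quasisimpleP; split=> // [|M /simL[->|->]].
- rewrite -derg1; have [L1|//] := simL _ (der_normal 1 L).
  by case/negP: abL; apply/derG1P.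
- by right; apply: sub1G.
- by left.
Qed.

(** [N] is a direct product of automorphic images of one simple group. If that group is nonabelian,
    the factors are components; if it were abelian, [N] would lie in ['F(N)], hence be solvable and
    so elementary abelian. *)
Lemma minnormal_layer N G : minnormal N G -> ~~ abelian N -> layer N = N.
Proof.
move=> minN abN; have chN := minnormal_charsimple minN.
have [H [sHN simH [I /subsetP sIA defN]]] := charsimple_dprod chN.
have genN : <<\bigcup_(f in I) f @: H>> = N := bigdprodWY defN.
have factor f : f \in I ->
    exists2 K : {group gT}, f @: H = K & [/\ K <| N & H \isog K].
  move=> If; have Af := sIA f If; exists (autm Af @* H)%G.
    by rewrite /= morphimEsub //= autmE.
  split; last by rewrite sub_isog ?injm_autm.
  have := defN; rewrite (bigD1 f) //= => /dprodP[[K1 K2 defK1 defK2] defN' cK _].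
  rewrite defK1 defK2 in defN' cK.
  suff -> : autm Af @* H = K1.
    by rewrite -[K1 <| N]/(gval K1 <| N) -defN' /normal mulG_subl mulG_subG normG cents_norm.
  by rewrite -defK1 morphimEsub //= autmE.
have abH : ~~ abelian H.
  apply: contra abN => abH.
  suff solN : solvable N.
    have := charsimple_solvable chN solN.
    by case/is_abelemP=> p _ /abelem_abelian.
  suff sNF : N \subset 'F(N) by apply: solvableS sNF (nilpotent_sol (Fitting_nil N)).
  rewrite -{1}genN gen_subG; apply/bigcupsP=> f If.
  have [K -> [nsKN isoK]] := factor f If.
  by rewrite Fitting_max ?abelian_nil // -(isog_abelian isoK).
apply/eqP; rewrite eqEsubset layer_sub -{1}genN gen_subG; apply/bigcupsP=> f If.
have [K -> [nsKN isoK]] := factor f If; apply: component_sub_layer.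
rewrite componentG normal_subnormal // simple_quasisimple //.
  by rewrite -(isog_simple isoK).
by rewrite -(isog_abelian isoK).
Qed.

Lemma Fstar_eq1 G : Fstar G = 1 -> G :=: 1.
Proof.
move=> F1; apply/eqP; apply: contraT => ntG.
have [N minN sNG] : {N : {group gT} | minnormal N G & N \subset G}.
  by apply: mingroup_exists; rewrite ntG normG.
have /andP[ntN nNG] := mingroupp minN.
have nsNG : N <| G by apply/andP.
case/negP: ntN; rewrite -subG1 -F1; have [abN|abN] := boolP (abelian N).
  by rewrite (subset_trans _ (joing_subl _ _)) // Fitting_max // abelian_nil.
rewrite -(minnormal_layer minN abN) (subset_trans _ (joing_subr _ _)) //.
exact/layer_subnormalS/normal_subnormal.
Qed.

End Components.

(** * Functoriality of the layer and of the generalized Fitting subgroup *)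

Lemma morphim_layer : GFunctor.continuous (@layer).
Proof.
move=> gT rT G f; rewrite sub_morphim_pre ?layer_sub //.
apply: layer_subP => [|L cL]; first exact: groupP.
have sLG := component_sub cL; rewrite -sub_morphim_pre //.
have [-> | ntfL] := eqVneq (f @* L) 1; first exact: sub1G.
move: cL; rewrite componentG => /andP[snL qsL].
rewrite (component_sub_layer (L := f @* L)) // componentG.
by rewrite morphim_subnormal //= morphim_quasisimple.
Qed.

Lemma morphim_Fstar : GFunctor.continuous (@Fstar).
Proof.
move=> gT rT G f; rewrite /Fstar morphimY ?Fitting_sub ?layer_sub //.
by rewrite genS ?setUSS ?morphim_layer // morphimF.
Qed.

Canonical Fstar_igFun := [igFun by Fstar_sub & morphim_Fstar].
Canonical Fstar_gFun := [gFun by morphim_Fstar].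

(* If [ker f \subset ker g], then [g] factors through [f], and continuity of [Fstar] applies. *)
Lemma Fstar_factor (aT rT1 rT2 : finGroupType) (X : {group aT})
    (f : {morphism X >-> rT1}) (g : {morphism X >-> rT2}) x :
  'ker f \subset 'ker g -> x \in X ->
  f x \in Fstar (f @* X) -> g x \in Fstar (g @* X).
Proof.
move=> kfg Xx Ffx; have sXX := subxx X.
have := morphim_Fstar [morphism of factm kfg sXX].
rewrite /= morphim_factm => /subsetP; apply.
rewrite -(factmE kfg sXX Xx) mem_morphim //.
exact: mem_morphim.
Qed.

(** Since [K] may stick out of [X], this can compare a factor [A] modulo a term of the series of [G]
    with [A] modulo a term of its own series. *)
Lemma Fstar_quotient_factor (gT : finGroupType) (X K M : {group gT}) x :
    X \subset 'N(K) -> X \subset 'N(M) -> X :&: K \subset M -> x \in X ->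
  coset K x \in Fstar (X / K) -> coset M x \in Fstar (X / M).
Proof.
move=> nKX nMX sXKM Xx FKx.
have := @Fstar_factor _ _ _ X [morphism of restrm nKX (coset K)]
                      [morphism of restrm nMX (coset M)] x.
rewrite /= !ker_restrm !ker_coset !morphim_restrm !setIid; apply=> //.
by rewrite subsetI subsetIl.
Qed.

(** The index comes first to give the shape of an object map; each term then gets a canonical group
    structure. *)
Definition Fseries n : GFunctor.object_map := fun gT => @FstarSeries gT n.

Lemma Fseries_group_set n : GFunctor.group_valued (Fseries n).
Proof. by move=> gT G; case: n => [|n]; apply: groupP. Qed.

Canonical Fseries_group n (gT : finGroupType) (G : {group gT}) :=
  Group (Fseries_group_set n G).

Lemma Fseries0 (gT : finGroupType) (G : {group gT}) : Fseries 0 G = 1.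
Proof. by []. Qed.

Lemma FseriesS (gT : finGroupType) n (G : {group gT}) :
  Fseries n.+1 G = coset (Fseries n G) @*^-1 Fstar (G / Fseries n G).
Proof. by []. Qed.

Lemma mem_FseriesS (gT : finGroupType) n (G : {group gT}) x :
  G \subset 'N(Fseries n G) -> x \in G ->
  (x \in Fseries n.+1 G) = (coset (Fseries n G) x \in Fstar (G / Fseries n G)).
Proof.
by move=> nFG Gx; rewrite FseriesS morphpreE in_setI (subsetP nFG x Gx) inE.
Qed.

(** * The generalized Fitting series *)

Lemma Fseries_normal n (gT : finGroupType) (G : {group gT}) : Fseries n G <| G.
Proof.
elim: n => [|n nsF]; first exact: normal1.
rewrite -[G in _ <| G](quotientGK nsF) FseriesS cosetpre_normal.
exact: gFnormal.
Qed.

Lemma Fseries_norm n (gT : finGroupType) (G : {group gT}) : G \subset 'N(Fseries n G).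
Proof. exact/normal_norm/Fseries_normal. Qed.

Lemma Fseries_sub n (gT : finGroupType) (G : {group gT}) : Fseries n G \subset G.
Proof. exact/normal_sub/Fseries_normal. Qed.

Section Push.

Variables (aT rT : finGroupType) (X : {group aT}) (f : {morphism X >-> rT}).

(** The indices are independent so that one step serves both arbitrary morphisms, which keep the
    index, and the projection onto [X / Fstar X], which lowers it by one. *)
Lemma Fseries_push n m :
  {in X, forall x, x \in Fseries n X -> f x \in Fseries m (f @* X)} ->
  {in X, forall x, x \in Fseries n.+1 X -> f x \in Fseries m.+1 (f @* X)}.
Proof.
move=> IH x Xx; have nFX := Fseries_norm n X; have nFfX := Fseries_norm m (f @* X)%G.
have fXfx : f x \in f @* X by rewrite mem_morphim.
rewrite !mem_FseriesS // => Fx.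
have sXdom : X \subset 'dom (coset (Fseries m (f @* X)) \o f).
  by rewrite /= -sub_morphim_pre.
have := @Fstar_factor _ _ _ X [morphism of restrm nFX (coset (Fseries n X))]
   [morphism of restrm sXdom (coset (Fseries m (f @* X)) \o f)] x.
rewrite /= !ker_restrm ker_comp !ker_coset !morphim_restrm !setIid morphim_comp.
apply=> //; rewrite subsetI subsetIl /=.
by apply/subsetP=> y /setIP[Xy Fy]; rewrite inE Xy inE IH.
Qed.

(** The hypothesis puts the preimage of [Fseries m (f @* X)] inside [Fseries n X], so
    [X / Fseries n X] is an image of [f @* X / Fseries m (f @* X)] and membership in [Fstar] travels
    backwards along [f]. *)
Lemma Fseries_lift n m :
  {in X, forall x, f x \in Fseries m (f @* X) -> x \in Fseries n X} ->
  {in X, forall x, f x \in Fseries m.+1 (f @* X) -> x \in Fseries n.+1 X}.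
Proof.
move=> IH x Xx; have nFX := Fseries_norm n X; have nFfX := Fseries_norm m (f @* X)%G.
have fXfx : f x \in f @* X by rewrite mem_morphim.
rewrite !mem_FseriesS // => Fx.
have sXdom : X \subset 'dom (coset (Fseries m (f @* X)) \o f).
  by rewrite /= -sub_morphim_pre.
have := @Fstar_factor _ _ _ X
   [morphism of restrm sXdom (coset (Fseries m (f @* X)) \o f)] 
   [morphism of restrm nFX (coset (Fseries n X))] x.
rewrite /= !ker_restrm ker_comp !ker_coset !morphim_restrm !setIid morphim_comp.
apply=> //; rewrite subsetI subsetIl /=.
by apply/subsetP=> y /setIP[Xy]; rewrite !inE => /andP[_]; apply: IH.
Qed.

Lemma Fseries_cont n :
  {in X, forall x, x \in Fseries n X -> f x \in Fseries n (f @* X)}.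
Proof.
elim: n => [|n IHn]; last exact: Fseries_push.
by move=> x _; rewrite !Fseries0 => /set1P->; rewrite morph1 group1.
Qed.

Lemma Fseries_full_morphim n : Fseries n X = X -> Fseries n (f @* X) = f @* X.
Proof.
move=> fullX; apply/eqP; rewrite eqEsubset Fseries_sub /=.
apply/subsetP=> _ /morphimP[x Xx _ ->]; apply: Fseries_cont => //.
by rewrite fullX.
Qed.

End Push.

(** [X / 1] and [X] have different types; [coset 1] and the identity have the same kernel on [X], so
    [Fstar_factor] transfers membership both ways. *)
Lemma Fseries1 (gT : finGroupType) (X : {group gT}) : Fseries 1 X = Fstar X.
Proof.
apply/setP=> x; have nX1 := norms1 X.
have [Xx|notXx] := boolP (x \in X); last first.
  rewrite (contraNF (subsetP (Fstar_sub X) x) notXx).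
  exact: (contraNF (subsetP (Fseries_sub 1 X) x) notXx).
rewrite mem_FseriesS // Fseries0; apply/idP/idP=> [|Fx].
  have := @Fstar_factor _ _ _ X [morphism of restrm nX1 (coset 1)] [morphism of idm X] x.
  rewrite /= ker_restrm ker_coset ker_idm morphim_restrm setIid morphim_idm //.
  by apply; rewrite ?subsetIr.
have := @Fstar_factor _ _ _ X [morphism of idm X] [morphism of restrm nX1 (coset 1)] x.
rewrite /= ker_restrm ker_coset ker_idm morphim_restrm setIid morphim_idm //.
by apply; rewrite ?sub1G.
Qed.

Section Series.

Variable gT : finGroupType.
Implicit Types (G H K X Z : {group gT}).

Lemma Fseries_subS n X : Fseries n X \subset Fseries n.+1 X.
Proof. by rewrite FseriesS sub_cosetpre. Qed.

Lemma Fseries_sub_leq m n X : m <= n -> Fseries m X \subset Fseries n X.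
Proof.
move/subnK <-; elim: (n - m) => // k IHk.
exact: subset_trans IHk (Fseries_subS _ _).
Qed.

Lemma Fseries_full_leq m n X : m <= n -> Fseries m X = X -> Fseries n X = X.
Proof.
move=> lemn fullX; apply/eqP; rewrite eqEsubset Fseries_sub -{1}fullX.
exact: Fseries_sub_leq.
Qed.

Lemma Fseries_proper n X :
  Fseries n X != X -> Fseries n X \proper Fseries n.+1 X.
Proof.
rewrite properEneq Fseries_subS andbT; apply: contraNneq => eqF.
have: Fstar (X / Fseries n X) = 1.
  by rewrite -[LHS]cosetpreK -FseriesS -eqF trivg_quotient.
move/Fstar_eq1/eqP; rewrite -subG1 quotient_sub1 ?Fseries_norm // => sXF.
by rewrite eqEsubset Fseries_sub.
Qed.

Lemma Fseries_card n X : Fseries n X = X \/ n < #|Fseries n X|.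
Proof.
elim: n => [|n IHn]; first by right; rewrite Fseries0 cards1.
have [fullX|ltF] := eqVneq (Fseries n X) X.
  by left; apply: Fseries_full_leq fullX.
right; case: IHn => [eqF|ltn]; first by rewrite eqF eqxx in ltF.
exact: leq_ltn_trans ltn (proper_card (Fseries_proper ltF)).
Qed.

Lemma Fseries_full_order X : Fseries #|X| X = X.
Proof.
case: (Fseries_card #|X| X) => // /leq_trans/(_ (subset_leq_card (Fseries_sub _ _))).
by rewrite ltnn.
Qed.

Lemma hstar_leq n X : Fseries n X = X -> hstar X <= n.
Proof.
move=> fullX; rewrite /hstar; set P := fun _ => _.
rewrite leqNgt; apply/negP=> lt_n.
have := before_find 0 lt_n; rewrite nth_iota ?add0n.
  by rewrite /P -/(Fseries n X) fullX eqxx.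
by apply: leq_trans lt_n _; rewrite -[X in _ <= X](size_iota 0) find_size.
Qed.

Lemma hstar_full X : Fseries (hstar X) X = X.
Proof.
have := hstar_leq (Fseries_full_order X); rewrite -ltnS; rewrite /hstar => ltX.
have /(nth_find 0) : has (fun n => FstarSeries n X == X) (iota 0 #|X|.+1).
  by rewrite has_find size_iota.
by rewrite nth_iota // => /eqP.
Qed.

Lemma Fseries_full_quotient n X K :
    X \subset 'N(K) -> Fseries n X = X -> Fseries n (X / K) = X / K.
Proof.
move=> nKX fullX.
have := @Fseries_full_morphim _ _ X [morphism of restrm nKX (coset K)] n fullX.
by rewrite /= morphim_restrm setIid.
Qed.

Lemma Fseries_full_quoS n X :
  Fseries n (X / Fstar X) = X / Fstar X -> Fseries n.+1 X = X.
Proof.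
have nFX : X \subset 'N(Fstar X) by apply: gFnorm.
set f := [morphism of restrm nFX (coset (Fstar X))].
have imf : f @* X = X / Fstar X by rewrite /= morphim_restrm setIid.
move=> fullXF; apply/eqP; rewrite eqEsubset Fseries_sub.
apply/subsetP=> x Xx; suff lift m :
    {in X, forall x, f x \in Fseries m (f @* X) -> x \in Fseries m.+1 X}.
  by apply: (lift n) => //=; rewrite [f @* X]imf fullXF mem_quotient.
elim: m => [y Xy|m IHm]; last exact: Fseries_lift.
rewrite Fseries0 => /set1P fy1; rewrite Fseries1.
by rewrite coset_idr // (subsetP nFX).
Qed.

Lemma Fseries_full_quo n X :
  Fseries n.+1 X = X -> Fseries n (X / Fstar X) = X / Fstar X.
Proof.
have nFX : X \subset 'N(Fstar X) by apply: gFnorm.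
set f := [morphism of restrm nFX (coset (Fstar X))].
have imf : f @* X = X / Fstar X by rewrite /= morphim_restrm setIid.
move=> fullX; apply/eqP; rewrite eqEsubset Fseries_sub /=.
suff push m : {in X, forall x, x \in Fseries m.+1 X -> f x \in Fseries m (f @* X)}.
  rewrite -imf; apply/subsetP=> _ /morphimP[x Xx _ ->].
  by rewrite push // fullX.
elim: m => [y Xy|m IHm]; last exact: Fseries_push.
by rewrite Fseries1 Fseries0 => Fy; apply/set1P; apply: coset_id.
Qed.

(** Lifts the components of a central quotient. If [M] is normal in [K^](1)[and]M /
    Z[is central in]K / Z[, then][~: M, K, K] =
    1[, and the three subgroups lemma makes]M[centralize]K^[(1)]. *)
Lemma quasisimple_der_central K Z :
    Z \subset 'Z(K) -> quasisimple (K / Z) -> quasisimple K^`(1) /\ K :=: K^`(1) * Z.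
Proof.
move=> sZ qsKZ; have [ntKZ perfKZ maxKZ] := quasisimpleP _ qsKZ.
have nsZK : Z <| K by exact: sub_center_normal.
have [sZK nZK] := andP nsZK; have cZK : Z \subset 'C(K).
  by rewrite (subset_trans sZ) ?subsetIr.
have nK'Z : Z \subset 'N(K^`(1)) by rewrite (subset_trans sZK) ?der_norm.
have nZK' : K^`(1) \subset 'N(Z) := subset_trans (der_sub 1 K) nZK.
have qK' : K^`(1) / Z = K / Z by rewrite quotient_der // derg1.
have defK : K :=: K^`(1) * Z.
  apply/eqP; rewrite eqEsubset mul_subG ?der_sub // andbT.
  by rewrite -normC // -quotientSK // qK'.
have derM H : H \subset K -> K \subset H * Z -> K^`(1) \subset H.
  move=> sHK sKHZ; have nHK : K \subset 'N(H).
    rewrite (subset_trans sKHZ) // mulG_subG normG cents_norm //.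
    by rewrite (subset_trans cZK) ?centS.
  rewrite der1_min // (abelianS (quotientS _ sKHZ)) // quotientMl ?normG //.
  rewrite trivg_quotient mul1g quotient_abelian //.
  exact: abelianS sZ (center_abelian _).
split=> //; apply/quasisimpleP; split.
- by apply: contraNneq ntKZ => K'1; rewrite /= -qK' K'1 quotient1.
- have sK''K : (K^`(1))^`(1) \subset K.
    by rewrite (subset_trans (der_sub 1 _)) ?der_sub.
  apply/eqP; rewrite -derg1 eqEsubset der_sub /= derM //.
  rewrite -normC; last exact: cents_norm (subset_trans cZK (centS sK''K)).
  by rewrite -quotientSK // quotient_der // qK' derg1 perfKZ.
move=> M /andP[sMK' nMK']; have sMK := subset_trans sMK' (der_sub 1 K).
have nZM := subset_trans sMK nZK.
have nsMZ : M / Z <| K / Z by rewrite -qK' quotient_normal // /normal sMK'.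
have [MZ|MZ] := maxKZ _ nsMZ.
  left; apply/eqP; rewrite eqEsubset sMK' derM //.
  rewrite -normC; last exact: cents_norm (subset_trans cZK (centS sMK)).
  by rewrite -quotientSK // MZ.
right; rewrite subsetI sMK' /=.
have sMKZ : [~: M, K] \subset Z.
  rewrite -quotient_cents2 //; exact: subset_trans MZ (subsetIr _ _).
have cMKK : [~: M, K, K] = 1 by apply/commG1P; apply: subset_trans cZK.
by apply/commG1P; rewrite commGC derg1; apply: three_subgroup; rewrite // [[~: K, M]]commGC.
Qed.

Lemma cosetpre_subnormal K (Sb : {group coset_of K}) X :
  K <| X -> Sb <|<| X / K -> coset K @*^-1 Sb <|<| X.
Proof.
move=> nsKX; have [m] := ubnP #|X|; elim: m X nsKX => // m IHm X nsKX leX snS.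
have [->|[Mb [snSM nsMb prMb]]] := subnormalEr snS.
  by rewrite quotientGK ?subnormal_refl.
have nsMX : coset K @*^-1 Mb <| X.
  by rewrite -(quotientGK nsKX) cosetpre_normal.
have prMX : coset K @*^-1 Mb \proper X.
  by rewrite -(quotientGK nsKX) cosetpre_proper.
apply: subnormal_trans (normal_subnormal nsMX).
apply: IHm; [exact: normal_cosetpre | | by rewrite /= cosetpreK].
exact: leq_trans (proper_card prMX) _.
Qed.

(** The preimage [P] of ['F(X / Z)] is nilpotent, as [P / 'Z(P)] is an image of [P / Z]; the
    preimage of a component of [X / Z] is a component of [X] times [Z], and [Z] lies in ['F(X)]. *)
Lemma Fstar_central X Z x : Z \subset 'Z(X) -> x \in X ->
  coset (gval Z) x \in Fstar (X / Z) -> x \in Fstar X.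
Proof.
move=> sZ Xx; have nsZX : Z <| X by exact: sub_center_normal.
have [sZX nZX] := andP nsZX.
have sZF : Z \subset 'F(X).
  rewrite Fitting_max // abelian_nil //.
  exact: abelianS sZ (center_abelian _).
suff sF : coset Z @*^-1 Fstar (X / Z) \subset Fstar X.
  by move=> Fx; rewrite (subsetP sF) // inE (subsetP nZX) ?inE.
rewrite -[Fstar X](quotientGK (H := Z)); last first.
  rewrite (normalS _ (Fstar_sub X)) //.
  by rewrite (subset_trans sZF) ?joing_subl.
rewrite cosetpreSK join_subG; apply/andP; split.
  rewrite -['F(X / Z)]cosetpreK quotientS //.
  rewrite (subset_trans _ (joing_subl _ _)) // Fitting_max //.
    by rewrite -(quotientGK nsZX) cosetpre_normal Fitting_normal.
    pose P := (coset Z @*^-1 'F(X / Z))%G; rewrite -[X in nilpotent X]/(gval P).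
    have sZP : Z \subset P by apply: sub_cosetpre.
    have sPX : P \subset X by rewrite -(quotientGK nsZX) cosetpreSK Fitting_sub.
    have nilPZ : nilpotent (P / Z) by rewrite cosetpreK Fitting_nil.
    have sZZP : Z \subset 'Z(P).
      by rewrite subsetI sZP (subset_trans sZ) // (subset_trans (subsetIr _ _)) ?centS.
    rewrite -quotient_center_nil.
    have nZP : P \subset 'N(Z) := subset_trans sPX nZX.
    have /homgP[f <-] := homg_quotientS nZP (gFnorm _ _) sZZP.
    exact: morphim_nil.
apply: layer_subP => [|Lb]; first exact: groupP.
rewrite componentG => /andP[snLb qsLb].
pose K := (coset Z @*^-1 Lb)%G; have defLb : K / Z = Lb by apply: cosetpreK.
have sZK : Z \subset K by apply: sub_cosetpre.
have snK : K <|<| X by apply: cosetpre_subnormal.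
have sKX := subnormal_sub snK.
have sZZK : Z \subset 'Z(K).
  by rewrite subsetI sZK (subset_trans sZ) // (subset_trans (subsetIr _ _)) ?centS.
have [|qsK' defK] := quasisimple_der_central sZZK; first by rewrite defLb.
rewrite -defLb quotientS // [gval K]defK mul_subG //.
  rewrite (subset_trans _ (joing_subr _ _)) // (component_sub_layer (L := K^`(1))) //.
  by rewrite componentG qsK' (subnormal_trans (normal_subnormal (der_normal 1 K)) snK).
by rewrite (subset_trans sZF) ?joing_subl.
Qed.

(** The index must be positive: a trivial [X / Z] only says that [X = Z]. *)
Lemma Fseries_full_central n X Z : Z \subset 'Z(X) ->
  Fseries n.+1 (X / Z) = X / Z -> Fseries n.+1 X = X.
Proof.
move=> sZ; have [sZX nZX] := andP (sub_center_normal sZ).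
set f := [morphism of restrm nZX (coset Z)].
have imf : f @* X = X / Z by rewrite /= morphim_restrm setIid.
move=> fullXZ; apply/eqP; rewrite eqEsubset Fseries_sub.
apply/subsetP=> x Xx; suff lift m :
    {in X, forall x, f x \in Fseries m.+1 (f @* X) -> x \in Fseries m.+1 X}.
  by apply: (lift n) => //; rewrite -imf in fullXZ; rewrite fullXZ mem_morphim.
elim: m => [y Xy|m IHm]; last exact: Fseries_lift.
by rewrite !Fseries1 /= morphim_restrm setIid; exact: (Fstar_central sZ Xy).
Qed.

End Series.

(** * Permutable subgroups *)

(** One half of [mutually_permutable], convertible with it; taken alone, it passes from [B] to all
    subgroups of [B]. *)
Definition permutes_subgroups (gT : finGroupType) (A B : {set gT}) : Prop :=
  forall H : {group gT}, H \subset B -> commute A H.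

Section Permutable.

Variable gT : finGroupType.
Implicit Types (A B G H K M N Q : {group gT}).

Lemma permutesS A B H : H \subset B ->
  permutes_subgroups A B -> permutes_subgroups A H.
Proof. by move=> sHB pAB K sKH; apply: pAB; apply: subset_trans sHB. Qed.

Lemma permutes_joing A B H : permutes_subgroups A B -> H \subset B -> A <*> H = A * H.
Proof. by move=> pAB sHB; rewrite comm_joingE //; apply: pAB. Qed.

Lemma permutes_capN A B N :
  permutes_subgroups A B -> permutes_subgroups (A :&: N) (B :&: N).
Proof.
move=> pAB H; rewrite subsetI => /andP[sHB sHN].
apply/comm_group_setP; by rewrite /= setIC group_modr // -(permutes_joing pAB) // groupP.
Qed.

(* Dedekind: [(A :&: B) * K = A :&: (B * K)]. *)
Lemma permutes_capl A B :
  permutes_subgroups B A -> permutes_subgroups (A :&: B) A.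
Proof.
move=> pBA K sKA; apply/comm_group_setP.
by rewrite group_modr // -(permutes_joing pBA) // groupP.
Qed.

Lemma permutes_quotient A B N :
    A \subset 'N(N) -> B \subset 'N(N) -> permutes_subgroups A B ->
  permutes_subgroups (A / N) (B / N).
Proof.
move=> nNA nNB pAB Hb sHb; pose H := (B :&: coset N @*^-1 Hb)%G.
have defHb : Hb = (H / N)%G.
  by apply: group_inj; rewrite /= quotient_setIpre (setIidPr sHb).
have nNH : H \subset 'N(N) by rewrite (subset_trans (subsetIl _ _)).
by rewrite defHb /commute -!quotientMl // (pAB H) ?subsetIl.
Qed.

Lemma mutually_permutable_sym A B :
  mutually_permutable A B -> mutually_permutable B A.
Proof. by case. Qed.

Lemma mutually_permutable_capN A B N :
  mutually_permutable A B -> mutually_permutable (A :&: N)%G (B :&: N)%G.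
Proof. by case=> pAB pBA; split; apply: permutes_capN. Qed.

Lemma permutes_cap_norm A B H N :
    permutes_subgroups A B -> H \subset B -> A \subset 'N(N) ->
  A \subset 'N((A <*> H) :&: N).
Proof. by move=> pAB sHB nNA; rewrite normsI // (subset_trans (joing_subl A H)) ?normG. Qed.

Lemma mutually_permutable_normal A B G N :
    A * B = G -> mutually_permutable A B -> N <| G ->
  (A :&: N) * (B :&: N) <| G /\ commute (A :&: N) (B :&: N).
Proof.
move=> defG mpAB /andP[sNG nNG]; have [pAB pBA] := mpAB.
have [pAB0 _] := mutually_permutable_capN N mpAB.
have cAB0 := pAB0 (B :&: N)%G (subxx _); split=> //.
have sAG : A \subset G by rewrite -defG mulG_subl.
have sBG : B \subset G by rewrite -defG mulG_subr.
have eqA : (A :&: N) * (B :&: N) = (A <*> (B :&: N)) :&: N.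
  by rewrite (permutes_joing pAB) ?subsetIl // [RHS]setIC -group_modr ?subsetIr // (setIC N).
have eqB : (A :&: N) * (B :&: N) = (B <*> (A :&: N)) :&: N.
  by rewrite (permutes_joing pBA) ?subsetIl // [RHS]setIC -group_modr ?subsetIr // (setIC N).
have nA : A \subset 'N((A :&: N) * (B :&: N)).
  by rewrite eqA (permutes_cap_norm pAB) ?subsetIl // (subset_trans sAG).
have nB : B \subset 'N((A :&: N) * (B :&: N)).
  by rewrite eqB (permutes_cap_norm pBA) ?subsetIl // (subset_trans sBG).
rewrite /normal mul_subG ?(subset_trans (subsetIl _ _)) //=.
by rewrite -{1}defG mul_subG.
Qed.

(** Writing [g] itself as [m * m' ^ g] gives [g = m' * m], so [g] lies in [M]. *)
Lemma mulg_conj_full G M g : g \in G -> M * (M :^ g) = G -> M :=: G.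
Proof.
move=> Gg defG; have: g \in M * (M :^ g) by rewrite defG.
case/mulsgP=> m _ Mm /imsetP[m' Mm' ->] /eqP; rewrite conjgE !mulgA.
rewrite -{1}[g]mul1g (can_eq (mulgK _)) => /eqP defg.
have Mg : g \in M.
  by rewrite -groupV -(groupMl _ Mm) -(groupMr _ Mm') -defg group1.
by rewrite -defG conjGid ?mulGid.
Qed.

(* Ore: maximal permutable proper subgroups are normal. *)
Lemma permutes_subnormal Q G :
  Q \subset G -> permutes_subgroups Q G -> Q <|<| G.
Proof.
have [m] := ubnP #|G|; elim: m G => // m IHm G leGm sQG pQG.
have [->|neqQG] := eqVneq Q G; first exact: subnormal_refl.
pose gP (M : {group gT}) := [&& Q \subset M, M \proper G &
  [forall (H : {group gT} | H \subset G), M * H == H * M]].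
have gQ : gP Q.
  rewrite /gP subxx properEneq sQG neqQG /=.
  by apply/forall_inP=> H sHG; apply/eqP/pQG.
have [M /maxgroupP[/and3P[sQM prMG /forall_inP pMG] maxM] _] := @maxgroup_exists _ gP Q gQ.
have sMG := proper_sub prMG.
have nsMG : M <| G.
  rewrite /normal sMG; apply/subsetP=> g Gg; rewrite inE.
  have pM H : H \subset G -> commute M H by move=> sHG; apply/eqP/pMG.
  have pMg H : H \subset G -> commute (M :^ g) H.
    move=> sHG; have sHg : (H :^ g^-1)%G \subset G.
      by rewrite /= sub_conjgV conjGid.
    have := pM _ sHg; rewrite /commute /= => /(congr1 (conjugate ^~ g)).
    by rewrite !conjsMg conjsgKV.
  have sMgG : M :^ g \subset G by rewrite -(conjGid Gg) conjSg.
  have cMMg : commute M (M :^ g) by apply: (pM (M :^ g)%G).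
  (* [K] again permutes with every subgroup of [G] and is proper by [mulg_conj_full], so maximality
     of [M] forces [M :^ g] into [M]. *)
  pose K := (M <*> (M :^ g))%G; have defK : K = M * M :^ g :> {set gT}.
    by rewrite /= comm_joingE.
  suff gK : gP K.
    by have defKM := maxM K gK (joing_subl _ _); apply: subset_trans (joing_subr M (M :^ g)) _; rewrite -[M <*> _]/(gval K) defKM.
  apply/and3P; split.
  - by rewrite (subset_trans sQM) ?joing_subl.
  - rewrite properEneq join_subG sMG sMgG !andbT.
    apply: contraNneq (proper_neq prMG) => defKG.
    by rewrite (mulg_conj_full Gg) // -defK defKG.
  apply/forall_inP=> H sHG; rewrite defK -mulgA (pMg H) //.
  by rewrite mulgA (pM H) // mulgA.
have snQM : Q <|<| M.
  apply: IHm => //; last exact: permutesS pQG.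
  exact: leq_trans (proper_card prMG) _.
exact: subnormal_trans snQM (normal_subnormal nsMG).
Qed.

(* Ito: [~ a, b] ^ (a1 * b1) = [~ a, b] ^ (b1 * a1), so [~: A, B] is abelian. *)
Lemma mulg_abelian_solvable A B G :
  A * B = G -> abelian A -> abelian B -> solvable G.
Proof.
move=> defG abA abB.
have defG' : A <*> B = G by rewrite comm_joingE //; apply/comm_group_setP; rewrite defG groupP.
have cA a1 a2 : a1 \in A -> a2 \in A -> a1 ^ a2 = a1.
  by move=> Aa1 Aa2; apply/conjg_fixP/commgP; apply: (centsP abA).
have cB b1 b2 : b1 \in B -> b2 \in B -> b1 ^ b2 = b1.
  by move=> Bb1 Bb2; apply/conjg_fixP/commgP; apply: (centsP abB).
have rA a1 a2 : a1 \in A -> a2 \in A -> [~ a1, a2] = 1.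
  by move=> Aa1 Aa2; apply/eqP/commgP; apply: (centsP abA).
have rB b1 b2 : b1 \in B -> b2 \in B -> [~ b1, b2] = 1.
  by move=> Bb1 Bb2; apply/eqP/commgP; apply: (centsP abB).
have key a b a1 b1 : a \in A -> b \in B -> a1 \in A -> b1 \in B ->
    [~ a, b] ^ (a1 * b1) = [~ a, b] ^ (b1 * a1).
  move=> Aa Bb Aa1 Bb1.
  have sAG : {subset A <= G} by apply/subsetP; rewrite -defG mulG_subl.
  have sBG : {subset B <= G} by apply/subsetP; rewrite -defG mulG_subr.
  have /mulsgP[a2 b2 Aa2 Bb2 def_b] : b ^ a1 \in A * B.
    by rewrite defG groupJ ?(sAG a1) ?(sBG b).
  have /mulsgP[a3' b3' Aa3' Bb3' def_a'] : a^-1 ^ b1 \in A * B.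
    by rewrite defG groupJ ?groupV ?(sAG a) ?(sBG b1).
  have [b3 [a3 [Bb3 Aa3 def_a]]] : exists b3 a3, [/\ b3 \in B, a3 \in A & a ^ b1 = b3 * a3].
    exists b3'^-1, a3'^-1; rewrite !groupV; split=> //.
    by rewrite -invMg -def_a' conjVg invgK.
  have -> : [~ a, b] ^ (a1 * b1) = [~ a3, b2].
    rewrite conjgM conjRg (cA a a1) // def_b commgMJ (rA a a2) // conj1g mulg1.
    by rewrite conjRg def_a (cB b2 b1) // commMgJ (rB b3 b2) // conj1g mul1g.
  rewrite conjgM conjRg (cB b b1) // def_a commMgJ (rB b3 b) // conj1g mul1g.
  by rewrite conjRg (cA a3 a1) // def_b commgMJ (rA a3 a2) // conj1g mulg1.
have abR : abelian [~: A, B].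
  rewrite abelian_gen; apply/subsetP=> _ /imset2P[a b Aa Bb ->].
  apply/centP=> _ /imset2P[a1 b1 Aa1 Bb1 ->]; apply/commgP/conjg_fixP.
  (* At the inverses, [key] turns conjugation by [a1^-1 * b1^-1] into conjugation by [(a1 * b1)^-1],
     which the remaining factor [a1 * b1] of [[~ a1, b1]] undoes. *)
  have := key a b a1^-1 b1^-1 Aa Bb; rewrite !groupV => /(_ Aa1 Bb1) eqc.
  have -> : [~ a1, b1] = a1^-1 * b1^-1 * (a1 * b1) by rewrite commgEl conjgE !mulgA.
  by rewrite conjgM eqc -conjgM mulgA mulgKV mulVg conjg1.
have nsR : [~: A, B] <| G by rewrite -defG' commg_normal.
have nRA := subset_trans (joing_subl A B) (commg_norm A B).
have nRB := subset_trans (joing_subr A B) (commg_norm A B).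
have abQ : abelian (G / [~: A, B]).
  by rewrite -defG' quotientY // abelianY !quotient_abelian //= centsC quotient_cents2 // commGC.
by rewrite (series_sol nsR) !abelian_sol.
Qed.

End Permutable.

(** * Products of simple groups *)

Lemma der1_norm_cyclic (gT : finGroupType) (A C : {group gT}) :
  A \subset 'N(C) -> cyclic C -> A^`(1) \subset 'C(C).
Proof.
move=> nCA cycC; have sA'N := subset_trans (der_sub 1 A) nCA.
rewrite -(ker_conj_aut C) ker_trivg_morphim sA'N /= morphim_der //.
have abA := abelianS (Aut_conj_aut C A) (Aut_cyclic_abelian cycC).
by rewrite (derG1P abA).
Qed.

(** As [A :&: B] lies in [H], Dedekind gives [H = AH :&: B] and then [KH = KB :&: AH], an
    intersection of two groups. *)
Lemma mutually_permutable_commute (gT : finGroupType) (A B H K : {group gT}) :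
    mutually_permutable A B -> H \subset B -> K \subset A -> A :&: B \subset H ->
  commute K H.
Proof.
case=> pAB pBA sHB sKA sDH; apply/comm_group_setP.
have defH : H :=: (A <*> H) :&: B.
  by rewrite (permutes_joing pAB) // [RHS]setIC -group_modr // setIC mulSGid.
by rewrite {1}defH setIC group_modl ?(subset_trans sKA) ?joing_subl // -(pBA K) // -(permutes_joing pBA) // groupP.
Qed.

Section SimpleProduct.

Variable gT : finGroupType.
Implicit Types (A B G H K M N P Q : {group gT}).

(** The number of Sylow subgroups of [PQ] conjugate to [P] divides [#|Q|] and is 1 modulo [#|P|];
    for equal primes [PQ] has order p^2 and is abelian. *)
Lemma prime_product_norm P Q :
    prime #|P| -> prime #|Q| -> #|Q| <= #|P| -> P :&: Q = 1 -> commute P Q ->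
  Q \subset 'N(P).
Proof.
move=> prP prQ leQP tiPQ cPQ; pose J := (P <*> Q)%G.
have defJ : J = P * Q :> {set gT} by rewrite /= comm_joingE.
have cardJ : #|J| = (#|P| * #|Q|)%N by rewrite defJ TI_cardMg.
have sPJ : P \subset J by apply: joing_subl.
have sQJ : Q \subset J by apply: joing_subr.
have [eqPQ | neqPQ] := eqVneq #|P| #|Q|.
  have abJ : abelian J by rewrite (card_p2group_abelian prP) // cardJ -eqPQ mulnn.
  by rewrite cents_norm // (subset_trans sQJ) // (subset_trans abJ) ?centS.
have ltQP : #|Q| < #|P| by rewrite ltn_neqAle eq_sym neqPQ.
have indP : #|J : P| = #|Q| by rewrite -divgS // cardJ mulKn ?prime_gt0.
have sylP : #|P|.-Sylow(J) P.
  rewrite /pHall sPJ /pgroup pnat_id //= indP p'natE //.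
  by rewrite (dvdn_prime2 prP prQ).
have := card_Syl_mod J prP; rewrite (card_Syl sylP).
have dvJ : #|J : 'N_J(P)| %| #|Q|.
  by rewrite -indP indexgS // subsetI sPJ normG.
have Qgt1 := prime_gt1 prQ.
case/primeP: prQ => _ /(_ _ dvJ)/pred2P[ind1 | ->].
  move=> _; apply: subset_trans sQJ _.
  have : J \subset 'N_J(P) by rewrite -indexg_eq1 ind1.
  by rewrite subsetI subxx.
by rewrite modn_small // => Q1; rewrite Q1 in Qgt1.
Qed.

Lemma simple_gen A (X : {set gT}) x :
  simple A -> X \subset A -> A \subset 'N(X) -> x \in X -> x != 1 -> <<X>> = A.
Proof.
case/simpleP=> _ simA sXA nXA Xx ntx.
have nsXA : <<X>>%G <| A by rewrite /normal gen_subG sXA norms_gen.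
have [X1|//] := simA _ nsXA.
by case/negP: ntx; rewrite -in_set1 -[[set 1]]X1 mem_gen.
Qed.

Definition prime_elements (A : {set gT}) (n : nat) :=
  [set x in A | prime #[x] & n <= #[x]].

Lemma prime_elements_norm A H n : H \subset 'N(A) -> H \subset 'N(prime_elements A n).
Proof.
move/subsetP=> nAH; apply/subsetP=> y Hy; rewrite inE; apply/subsetP=> _ /imsetP[x Xx ->].
move: Xx; rewrite !inE orderJ => /andP[Ax ->]; rewrite andbT.
by rewrite memJ_norm ?nAH.
Qed.

Lemma simple_gen_prime A : simple A -> <<prime_elements A 0>> = A.
Proof.
move=> simA; have [ntA _] := simpleP _ simA.
have [p prp pA] : exists2 p, prime p & p %| #|A|.
  by exists (pdiv #|A|); rewrite ?pdiv_dvd // pdiv_prime ?cardG_gt1.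
have [x Ax ox] := Cauchy prp pA.
apply: (simple_gen (x := x)) => //.
- by apply/subsetP=> y; rewrite inE => /andP[].
- exact: prime_elements_norm (normG A).
- by rewrite inE Ax ox prp.
by rewrite -order_gt1 ox prime_gt1.
Qed.

(** If [A] has elements of prime order at least [#|P|], they generate [A], and [P] normalizes each
    of their cyclic groups. Otherwise every element of prime order normalizes [P], and these
    elements generate [A]. *)
Lemma prime_permutes_simple A P :
    simple A -> prime #|P| -> P :&: A = 1 -> permutes_subgroups P A ->
  P \subset 'N(A) \/ A \subset 'N(P).
Proof.
move=> simA prP tiPA pPA.
have prk k : k \in A -> prime #[k] -> P :&: <[k]> = 1 /\ commute P <[k]>.
  move=> Ak _; have sKA : <[k]> \subset A by rewrite cycle_subG.
  by split; [apply/trivgP; rewrite -tiPA setIS | apply: pPA].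
have [X0 | [x Xx]] := set_0Vmem (prime_elements A #|P|).
  right; rewrite -(simple_gen_prime simA) gen_subG; apply/subsetP=> k.
  rewrite inE => /and3P[Ak prk_ _]; have [tiPk cPk] := prk k Ak prk_.
  rewrite -cycle_subG prime_product_norm //; apply: contraT; rewrite -ltnNge => ltP.
  have : k \in prime_elements A #|P| by rewrite inE Ak prk_ ltnW.
  by rewrite X0 inE.
left; have ntx : x != 1.
  by move: Xx; rewrite inE -order_gt1 => /and3P[_ /prime_gt1].
have nXA := prime_elements_norm #|P| (normG A).
have sXA : prime_elements A #|P| \subset A by apply/subsetP=> y; rewrite inE => /andP[].
rewrite -(simple_gen simA sXA nXA Xx ntx) norms_gen //.
apply/subsetP=> t Pt; rewrite inE; apply/subsetP=> _ /imsetP[k Xk ->].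
move: Xk; rewrite !inE orderJ => /and3P[Ak prk_ lek]; rewrite prk_ lek !andbT.
have [tiPk cPk] := prk k Ak prk_.
have nKP : P \subset 'N(<[k]>).
  by apply: prime_product_norm; rewrite // setIC.
have : k ^ t \in <[k]> by rewrite memJ_norm ?cycle_id ?(subsetP nKP).
by apply: subsetP; rewrite cycle_subG.
Qed.

(* A :&: B is subnormal in A, so it lies in a maximal normal subgroup A1 of A, all of whose conjugates
   lie in the proper subgroup B A1. *)
Lemma simple_mutually_permutable_factor A B G :
    simple G -> A * B = G -> mutually_permutable A B -> A :!=: G -> B :!=: G ->
  simple A /\ A :&: B = 1.
Proof.
move=> /simpleP[ntG simG] defG [pAB pBA] neqAG neqBG.
have sAG : A \subset G by rewrite -defG mulG_subl.
have sBG : B \subset G by rewrite -defG mulG_subr.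
have snD : A :&: B <|<| A by apply: permutes_subnormal (permutes_capl pBA); apply: subsetIl.
have [defD|[K [snDK nsKA prKA]]] := subnormalEr snD.
  by case/eqP: neqBG; rewrite -defG mulSGid // -defD subsetIr.
have [A1 maxA1 sKA1] : {M : {group gT} | maxnormal M A A & K \subset M}.
  by apply: maxgroup_exists; rewrite prKA normal_norm.
have nsA1 := maxnormal_normal maxA1; have prA1 := maxnormal_proper maxA1.
have sA1A := normal_sub nsA1.
have sDA1 : A :&: B \subset A1 by rewrite (subset_trans (subnormal_sub snDK)).
pose V := (B <*> A1)%G; have defV : V = B * A1 :> {set gT}.
  by rewrite /= (permutes_joing pBA).
have prVG : V \proper G.
  rewrite properEneq join_subG sBG (subset_trans sA1A) // !andbT.
  apply: contraNneq (proper_neq prA1) => defVG.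
  by rewrite -(mulSGid sDA1) group_modr // -defV defVG (setIidPl _).
have sA1GV : class_support A1 G \subset V.
  rewrite class_supportEr; apply/bigcupsP=> g; rewrite -{1}defG => /mulsgP[a b Aa Bb ->].
  rewrite conjsgM (normsP (normal_norm nsA1)) //.
  have Vb : b \in V by rewrite (subsetP (joing_subl B A1)).
  by rewrite -(conjGid Vb) conjSg joing_subr.
have nsV1 : <<class_support A1 G>>%G <| G.
  rewrite /normal gen_subG norms_gen ?class_support_norm // andbT.
  exact: subset_trans sA1GV (proper_sub prVG).
have [V1|VG] := simG _ nsV1; last first.
  have : G \subset V by rewrite -[gval G]VG /= gen_subG.
  by move/subset_leq_card; rewrite leqNgt proper_card.
have A11 : A1 :=: 1.
  apply/trivgP; rewrite -V1 /= sub_gen // class_supportEr (bigcup_max 1) ?group1 //.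
  by rewrite conjsg1.
split; last by apply/trivgP; rewrite -A11.
by rewrite simple_maxnormal -A11.
Qed.

(** Two proper factors would be simple with trivial intersection. If [A] is nonabelian, each element
    [t] of prime order in [B] normalizes [A]: otherwise [A] normalizes [<[t]>], and being perfect
    centralizes it. Then [A] would be normal in [G]. So both factors are abelian, and [G] is
    solvable by Ito, hence of prime order. *)
Lemma simple_mutually_permutable A B G :
  simple G -> A * B = G -> mutually_permutable A B -> A :=: G \/ B :=: G.
Proof.
move=> simG defG mpAB; have [ntG simpG] := simpleP _ simG.
have [|neqAG] := eqVneq (gval A) G; first by left.
have [|neqBG] := eqVneq (gval B) G; first by right.
have mpBA := mutually_permutable_sym mpAB; have [pAB pBA] := mpAB.
have defGr : B * A = G by rewrite -defG (pAB B).
have sAG : A \subset G by rewrite -defG mulG_subl.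
have sBG : B \subset G by rewrite -defG mulG_subr.
have [simA tiAB] := simple_mutually_permutable_factor simG defG mpAB neqAG neqBG.
have [simB _] := simple_mutually_permutable_factor simG defGr mpBA neqBG neqAG.
have nonnormal (A1 B1 : {group gT}) : A1 * B1 = G -> simple A1 -> A1 :!=: G -> ~~ (B1 \subset 'N(A1)).
  move=> defG1 /simpleP[ntA1 _] neqA1; apply/negP=> nA1B1.
  have nsA1 : A1 <| G by rewrite /normal -defG1 mulG_subl mul_subG ?normG.
  by have [A11|A1G] := simpG _ nsA1; [rewrite A11 eqxx in ntA1 | rewrite A1G eqxx in neqA1].
have abel (A1 B1 : {group gT}) : A1 * B1 = G -> mutually_permutable B1 A1 ->
    A1 :&: B1 = 1 -> simple A1 -> simple B1 -> A1 :!=: G -> abelian A1.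
  move=> defG1 mpB1A1 ti1 simA1 simB1 neqA1; apply: contraT => abA1.
  case/negP: (nonnormal A1 B1 defG1 simA1 neqA1).
  rewrite -(simple_gen_prime simB1) gen_subG; apply/subsetP=> t.
  rewrite inE -cycle_subG orderE => /and3P[sPB prP _].
  have pPA : permutes_subgroups <[t]> A1.
    move=> K sKA; apply: (mutually_permutable_commute mpB1A1) => //.
    by rewrite setIC ti1 sub1G.
  have tiP : <[t]> :&: A1 = 1 by apply/trivgP; rewrite /= setIC -ti1 setIS.
  rewrite -cycle_subG; have [//|nPA1] := prime_permutes_simple simA1 prP tiP pPA.
  rewrite cents_norm // centsC.
  rewrite -(quasisimple_perfect (simple_quasisimple simA1 abA1)) -derg1.
  by rewrite der1_norm_cyclic ?cycle_cyclic.
have abA : abelian A by apply: (abel A B).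
have abB : abelian B by apply: (abel B A); rewrite // setIC.
have solG := mulg_abelian_solvable defG abA abB.
have abG : abelian G by apply/cyclic_abelian/prime_cyclic/simple_sol_prime.
case/negP: (nonnormal A B defG simA neqAG).
by rewrite cents_norm // (subset_trans sBG) // (subset_trans abG) ?centS.
Qed.

End SimpleProduct.

(** * Invariant Sylow subgroups *)

Section PrimeSections.

Variable gT : finGroupType.
Implicit Types (A B G H K N P S T U V Y : {group gT}).

Lemma quotient_prime_index T U : U <| T -> prime #|T : U| -> prime #|T / U|.
Proof. by case/andP=> _ nUT; rewrite card_quotient. Qed.

Lemma der1_prime_section A T U :
    A \subset 'N(T) -> A \subset 'N(U) -> U <| T -> prime #|T : U| ->
  [~: T, A^`(1)] \subset U.
Proof.
move=> nTA nUA nsUT prTU; have nUA' := subset_trans (der_sub 1 A) nUA.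
rewrite -quotient_cents2 ?(normal_norm nsUT) // centsC quotient_der //.
rewrite der1_norm_cyclic ?quotient_norms //.
exact/prime_cyclic/quotient_prime_index.
Qed.

Lemma coprime_prime_section Y T U :
    Y \subset 'N(T) -> Y \subset 'N(U) -> U <| T -> prime #|T : U| ->
  coprime #|Y| #|T : U|.-1 -> [~: T, Y] \subset U.
Proof.
move=> nTY nUY nsUT prTU coY; have prq := quotient_prime_index nsUT prTU.
have nQ : Y / U \subset 'N(T / U) by apply: quotient_norms.
rewrite -quotient_cents2 ?(normal_norm nsUT) // centsC.
rewrite -(ker_conj_aut (T / U)) ker_trivg_morphim nQ /=.
rewrite subG1 trivg_card1 -dvdn1 -(eqP coY) dvdn_gcd.
rewrite (dvdn_trans (dvdn_morphim _ _)) ?dvdn_quotient //=.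
rewrite (dvdn_trans (cardSg (Aut_conj_aut _ _))) //.
by rewrite card_Aut_cyclic ?prime_cyclic // totient_prime // card_quotient ?(normal_norm nsUT).
Qed.

Lemma stable_coprime_cents T U Y :
    U <| T -> solvable T -> coprime #|T| #|Y| -> Y \subset 'N(U) ->
    [~: T, Y] \subset U -> Y \subset 'C(U) ->
  Y \subset 'C(T).
Proof.
move=> /andP[sUT nUT] solT coTY nUY sTYU cUY.
have nTY : Y \subset 'N(T) by rewrite -commg_subl (subset_trans sTYU).
have cTU : T / U \subset 'C(Y / U) by rewrite quotient_cents2.
have := coprime_quotient_cent sUT nUY coTY solT; rewrite (setIidPl cTU) => eqQ.
rewrite centsC; have sUC : U \subset 'C_T(Y) by rewrite subsetI sUT centsC.
have : T \subset 'C_T(Y).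
  by rewrite -(quotientSGK nUT sUC) eqQ.
by rewrite subsetI => /andP[].
Qed.

Lemma permutes_chain A N S Y p :
    A \subset 'N(N) -> A :&: N = 1 -> prime p -> p.-group S -> S \subset A * N ->
    permutes_subgroups A S -> Y \subset A -> p^'.-group Y ->
    (forall T U, A \subset 'N(T) -> A \subset 'N(U) -> U <| T -> #|T : U| = p ->
       [~: T, Y] \subset U) ->
  p.-group ((A <*> S) :&: N) /\ Y \subset 'C((A <*> S) :&: N).
Proof.
move=> nNA tiAN prp; have [m] := ubnP #|S|; elim: m S => // m IHm S ltS pS sSAN pAS sYA p'Y hY.
have [S1|ntS] := eqVneq S 1%G.
  by rewrite S1 (joing_idPl (sub1G A)) tiAN pgroup1 cents1.
have [R maxR _] : exists2 R : {group gT}, maximal R S & 1%G \subset R.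
  by have [eqS|//] := maximal_exists (sub1G S); case/eqP: ntS; apply: group_inj.
have [sRS nRS] := andP (p_maximal_normal pS maxR); have iSR := p_maximal_index pS maxR.
have ltRm : #|R| < m by apply: leq_trans (proper_card (maxgroupp maxR)) _.
have [] := IHm R ltRm (pgroupS sRS pS) (subset_trans sRS sSAN) (permutesS sRS pAS) sYA p'Y hY.
set AR := (A <*> R)%G; set AS := (A <*> S)%G.
have defAR : AR = A * R :> {set gT} by rewrite /= (permutes_joing pAS).
have defAS : AS = A * S :> {set gT} by rewrite /= (permutes_joing pAS).
have sARAS : AR \subset AS by rewrite genS ?setUS.
pose U := (AR :&: N)%G; pose T := (AS :&: N)%G => pU cUY.
have nUA : A \subset 'N(U) by rewrite normsI // (subset_trans (joing_subl A R)) ?normG.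
have nTA : A \subset 'N(T) by rewrite normsI // (subset_trans (joing_subl A S)) ?normG.
have sUT : U \subset T by rewrite setSI.
have sASAN : AS \subset A * N.
  rewrite -norm_joinEl // in sSAN *.
  by rewrite join_subG joing_subl.
(* Comparing this count for [AS] and [AR] shows that [#|T : U|] is the index of [S :&: AR] in [S], a
   divisor of [#|S : R| = p]. *)
have mulAT (H : {group gT}) : A \subset H -> H \subset A * N -> #|H| = (#|A| * #|(H :&: N)%G|)%N.
  move=> sAH sHAN; rewrite -TI_cardMg; last first.
    by apply/trivgP; rewrite -tiAN setIS ?subsetIr.
  by rewrite /= setIC group_modl // (setIidPr sHAN).
have cardT : #|T| = (#|U| * #|S : AR|)%N.
  apply/eqP; rewrite -(eqn_pmul2l (cardG_gt0 A)) mulnA -!mulAT ?joing_subl //.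
    by rewrite LagrangeMl defAR -mulgA (mulSGid sRS) -defAS.
  exact: subset_trans sARAS sASAN.
have : #|S : AR| %| p.
  by rewrite -iSR -indexgI indexgS // subsetI sRS joing_subr.
case/primeP: (prp) => _ dvp /dvp/pred2P[ind1 | indp].
  have eqTU : T :=: U.
    by apply/eqP; rewrite eq_sym eqEcard sUT cardT ind1 muln1 /=.
  by rewrite -[_ :&: _]/(gval T) eqTU.
have pT : p.-group T by rewrite /pgroup cardT indp pnatM pnat_id // andbT; apply: pU.
have indTU : #|T : U| = p by rewrite -divgS // cardT indp mulKn.
split=> //; have maxU : maximal U T by rewrite p_index_maximal ?indTU.
have nsUT := p_maximal_normal pT maxU.
have sTYU := hY T U nTA nUA nsUT indTU.
apply: (stable_coprime_cents nsUT) => //.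
- exact: pgroup_sol pT.
- exact: pnat_coprime pT p'Y.
exact: subset_trans sYA nUA.
Qed.

(* V = C_V(P) R for a Sylow r-subgroup R containing P, so all conjugates of P lie in R. *)
Lemma pcore_index_cent (r : nat) P V :
  P \subset V -> r.-group P -> r.-nat #|V : 'C_V(P)| -> P \subset 'O_r(V).
Proof.
move=> sPV rP rind; have [R sylR sPR] := Sylow_superset sPV rP.
have sRV := pHall_sub sylR.
have defV : 'C_V(P) * R = V.
  apply: coprime_index_mulG; rewrite ?subsetIl //.
  by apply: pnat_coprime rind _; case/and3P: sylR.
have sPVR : class_support P V \subset R.
  rewrite class_supportEr; apply/bigcupsP=> g; rewrite -defV => /mulsgP[c x].
  case/setIP=> _ cPc Rx ->; rewrite conjsgM (normP (subsetP (cent_sub P) c cPc)).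
  by rewrite -(conjGid Rx) conjSg.
have sPc : P \subset <<class_support P V>>.
  by rewrite sub_gen // class_supportEr (bigcup_max 1) ?group1 // conjsg1.
apply: subset_trans sPc _; apply: pcore_max.
  by apply: pgroupS (pHall_pgroup sylR); rewrite gen_subG.
rewrite /normal gen_subG norms_gen ?class_support_norm // andbT.
exact: subset_trans sPVR sRV.
Qed.

Lemma Sylow_sub_gen G H :
  (forall p, prime p -> exists2 P : {group gT}, P \subset H & p.-Sylow(G) P) -> G \subset H.
Proof.
move=> sylH; pose X := [set P : {group gT} | P \subset G :&: H].
have <- : <<\bigcup_(P in X) P>> = G.
  apply: Sylow_transversal_gen => [P|p]; first by rewrite inE subsetI => /andP[].
  rewrite mem_primes => /andP[prp _]; have [P sPH sylP] := sylH p prp.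
  by exists P => //; rewrite inE subsetI sPH (pHall_sub sylP).
by rewrite gen_subG; apply/bigcupsP=> Q; rewrite inE subsetI => /andP[].
Qed.

(* The commutator of an r-element and an r'-element of Y centralizes every T in the
   hypothesis, as one of the two does; so Y is nilpotent. Each Sylow r-subgroup of Y then centralizes
   a subgroup of r-power index in N, and [pcore_index_cent] applies. *)
Lemma coprime_action_Fitting Y N :
    Y \subset 'N(N) -> 'C_Y(N) = 1 ->
    (forall q, prime q -> exists T : {group gT},
       [/\ q.-Sylow(N) T, Y \subset 'N(T) &
           forall Z : {group gT}, Z \subset Y -> q^'.-group Z -> Z \subset 'C(T)]) ->
  Y \subset 'F(Y <*> N).
Proof.
move=> nNY tiC sylN.
have cNsyl (Z : {group gT}) : Z \subset Y ->
    (forall q T, prime q -> q.-Sylow(N) T -> Y \subset 'N(T) ->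
      (forall Z : {group gT}, Z \subset Y -> q^'.-group Z -> Z \subset 'C(T)) -> Z \subset 'C(T)) ->
    Z :=: 1.
  move=> sZY cZT; apply/trivgP; rewrite -tiC subsetI sZY centsC.
  apply: Sylow_sub_gen => q prq; have [T [sylT nTY cT]] := sylN q prq.
  by exists T; rewrite // centsC (cZT q).
have comm (r : nat) (Z W : {group gT}) : Z \subset Y -> W \subset Y -> r.-group Z -> r^'.-group W ->
    W \subset 'C(Z).
  move=> sZY sWY rZ r'W; rewrite centsC; apply/commG1P; apply: (cNsyl [~: Z, W]%G).
    by rewrite (subset_trans (commgSS sZY sWY)) // -derg1 der_sub.
  move=> q T prq sylT nTY cT; have nCY : Y \subset 'N('C_Y(T)) by rewrite normsI ?normG ?norms_cent.
  suff: [~: Z, W] \subset 'C_Y(T) by rewrite subsetI => /andP[].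
  have [eqr | neqr] := eqVneq q r.
    rewrite (subset_trans (commgSS sZY _) (_ : [~: Y, 'C_Y(T)] \subset _)) ?commg_subr //.
    by rewrite subsetI sWY cT // eqr.
  rewrite (subset_trans (commgSS _ sWY) (_ : [~: 'C_Y(T), Y] \subset _)) ?commg_subl //.
  rewrite subsetI sZY cT //; apply: pi_pgroup rZ _.
  by rewrite !inE eq_sym.
apply: Sylow_sub_gen => r prr; have [P sylP] := Sylow_exists r Y; exists P => //.
have sPY := pHall_sub sylP; have rP := pHall_pgroup sylP.
have nPY : Y \subset 'N(P).
  apply: Sylow_sub_gen => q prq; have [->|neqr] := eqVneq q r.
    by exists P; rewrite ?normG.
  have [Q sylQ] := Sylow_exists q Y; exists Q => //.
  rewrite cents_norm // (comm r) ?(pHall_sub sylQ) //.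
  apply: pi_pgroup (pHall_pgroup sylQ) _; by rewrite !inE.
have nNP := subset_trans sPY nNY; pose V := (P <*> N)%G.
have defV : V = P * N :> {set gT} by rewrite /= norm_joinEl.
have sNV : N \subset V by apply: joing_subr.
have nsV : V <| Y <*> N.
  rewrite /normal genS ?setSU //= join_subG normsY //=.
  by rewrite (subset_trans _ (normG V)) ?joing_subr.
have rV : r.-nat #|V : 'C_V(P)|.
  apply/pnatP=> // q prq qdv; rewrite inE; apply: contraLR qdv => neqr.
  have [T [sylT nTY cT]] := sylN q prq; have sTN := pHall_sub sylT.
  have sTV := subset_trans sTN sNV.
  rewrite -p'natE //; apply: (@pnat_dvd _ #|V : T|).
    rewrite indexgS // subsetI sTV centsC cT //.
    by apply: pi_pgroup rP _; rewrite !inE eq_sym.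
  rewrite -(Lagrange_index sNV sTN) pnatM; case/and3P: sylT => _ _ ->; rewrite andbT.
  have -> : #|V : N| = #|P : N|.
    by apply/eqP; rewrite -(eqn_pmul2r (cardG_gt0 N)) mulnC Lagrange // LagrangeMr -defV.
  rewrite (pnat_dvd (dvdn_indexg _ _)) //; apply: pi_pnat rP _.
  by rewrite !inE eq_sym.
have sPO := pcore_index_cent (joing_subl P N) rP rV.
apply: subset_trans sPO _; rewrite Fitting_max //.
  exact: gFnormal_trans.
exact: pgroup_nil (pcore_pgroup r V).
Qed.

End PrimeSections.

Section PermutesDerived.

Variable gT : finGroupType.
Implicit Types (A B H N S T : {group gT}).

(** [S] is a Sylow subgroup of [B1 = B :&: AN], for which [AB1 = AN]. Traces on [N] of subgroups [H]
    of [B1] have order [#|H : A|], so the index of the trace of [S] divides [#|B1 : S|]. *)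
Lemma permutes_Sylow A B N q :
    A \subset 'N(N) -> A :&: N = 1 -> N \subset A * B -> permutes_subgroups A B ->
    prime q ->
  exists S : {group gT}, [/\ q.-group S, S \subset B, S \subset A * N & q.-Sylow(N) ((A <*> S) :&: N)].
Proof.
move=> nNA tiAN sNAB pAB prq; pose B1 := (B :&: (A <*> N))%G.
have defAN : A * N = A <*> N by rewrite norm_joinEl.
have defAB1 : A * B1 = A * N.
  rewrite defAN /= group_modl ?joing_subl //; apply/setIidPr.
  by rewrite /= -defAN -{2}[gval A]mulGid -mulgA mulgS.
have cardAH (H : {group gT}) : permutes_subgroups A H -> H \subset A <*> N ->
    #|(A <*> H) :&: N| = #|H : A|.
  move=> pAH sHAN; apply/eqP; rewrite -(eqn_pmul2l (cardG_gt0 A)) LagrangeMl.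
  rewrite -(permutes_joing pAH) // -TI_cardMg; last first.
    by apply/trivgP; rewrite -tiAN setIS ?subsetIr.
  rewrite /= setIC group_modl ?joing_subl // (setIidPr _) //.
  by rewrite defAN join_subG joing_subl.
have [S sylS] := Sylow_exists q B1; have qS := pHall_pgroup sylS.
have sSB1 := pHall_sub sylS; have sSB := subset_trans sSB1 (subsetIl _ _).
have sSAN := subset_trans sSB1 (subsetIr _ _).
exists S; rewrite defAN; split=> //; set T := _ :&: N.
have cardT : #|T| = #|S : A| by apply: cardAH => //; apply: permutesS pAB.
have cardN : #|N| = #|B1 : A|.
  rewrite -cardAH ?subsetIr //; last by apply: permutesS pAB; apply: subsetIl.
  rewrite (permutes_joing pAB) ?subsetIl // defAB1 defAN (setIidPr _) ?joing_subr //.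
have sTN : T \subset N by apply: subsetIr.
have dvST : #|S : A| %| #|S| by rewrite dvdn_indexg.
rewrite /pHall sTN /pgroup cardT (pnat_dvd dvST) //=.
apply: (@pnat_dvd _ #|B1 : S|); last by case/and3P: sylS.
have sSAB1A : S :&: A \subset B1 :&: A by rewrite setSI.
apply/dvdnP; exists #|B1 :&: A : S :&: A|.
apply/eqP; rewrite -(eqn_pmul2l (cardG_gt0 S)) Lagrange //.
rewrite -(Lagrange (subsetIl B1 A)) indexgI -cardN -(Lagrange sTN) cardT.
rewrite -(Lagrange sSAB1A) -[in X in _ == X](Lagrange (subsetIl S A)) indexgI.
by rewrite -!mulnA eqn_mul2l; apply/orP; right; rewrite mulnCA.
Qed.

Lemma permutes_der1_subnormal A B N :
    A \subset 'N(N) -> A :&: N = 1 -> N \subset A * B -> permutes_subgroups A B ->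
  A^`(1) <|<| A^`(1) <*> N.
Proof.
move=> nNA tiAN sNAB pAB; have sA'A := der_sub 1 A.
have nNA' := subset_trans sA'A nNA.
have sylN q : prime q -> exists T : {group gT},
    [/\ q.-Sylow(N) T, A \subset 'N(T) &
        forall Z : {group gT}, Z \subset A^`(1) -> q^'.-group Z -> Z \subset 'C(T)].
  move=> prq; have [S [qS sSB sSAN sylT]] := permutes_Sylow nNA tiAN sNAB pAB prq.
  exists ((A <*> S) :&: N)%G; split=> // [|Z sZA' q'Z].
    by rewrite normsI // (subset_trans (joing_subl A S)) ?normG.
  have pAS := permutesS sSB pAB.
  have [|_ //] := permutes_chain nNA tiAN prq qS sSAN pAS (subset_trans sZA' sA'A) q'Z.
  move=> T U nTA nUA nsUT indTU; apply: subset_trans (commgS T sZA') _.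
  by apply: der1_prime_section; rewrite ?indTU.
pose C := 'C_(A^`(1))(N)%G; pose W := (A^`(1) <*> N)%G.
have sCA' : C \subset A^`(1) by apply: subsetIl.
have nCA' : A^`(1) \subset 'N(C) by rewrite normsI ?normG ?norms_cent.
have nCN : N \subset 'N(C) by rewrite cents_norm // centsC subsetIr.
have nsCW : C <| W.
  by rewrite /normal (subset_trans sCA') ?joing_subl // join_subG nCA'.
have sYF : A^`(1) / C \subset 'F(W / C).
  rewrite quotientY //; apply: coprime_action_Fitting.
  - exact: quotient_norms.
  (* The action stays faithful modulo [C]: [[~: K, N]] lies in [C] and in [N], hence in
     [A :&: N = 1]. *)
  - pose K := (A^`(1) :&: coset C @*^-1 'C(N / C))%G.
    have sKA' : K \subset A^`(1) by apply: subsetIl.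
    have nCK := subset_trans sKA' nCA'.
    have defK : K / C = 'C_(A^`(1) / C)(N / C) by apply: quotient_setIpre.
    rewrite -defK quotientS1 // subsetI sKA' /=; apply/commG1P/trivgP.
    rewrite -tiAN subsetI commg_subr (subset_trans sKA') // andbT.
    apply: subset_trans (subset_trans sCA' sA'A).
    by rewrite -quotient_cents2 // defK subsetIr.
  move=> q prq; have [T [sylT nTA cT]] := sylN q prq.
  have nCT : T \subset 'N(C) := subset_trans (pHall_sub sylT) nCN.
  exists (T / C)%G; split.
  - exact: quotient_pHall.
  - by rewrite quotient_norms // (subset_trans sA'A).
  move=> Zb sZb q'Zb; apply/subsetP=> zb Zzb.
  have /morphimP[z nCz A'z def_zb] := subsetP sZb zb Zzb.
  (* A q'-element of the quotient is the image of the q'-part of any preimage, to which [cT]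
     applies. *)
  have zq1 : zb.`_q = 1 by apply/constt1P; apply: mem_p_elt Zzb.
  have Czq : z.`_q \in C.
    by apply: coset_idr; rewrite ?groupX // morph_constt // -def_zb.
  have -> : zb = coset C z.`_q^'.
    by rewrite def_zb -[z in LHS](consttC q) /= coset_kerl.
  have cTz : <[z.`_q^']> \subset 'C(T).
    apply: (cT <[z.`_q^']>%G); first by rewrite cycle_subG groupX.
    exact: p_elt_constt.
  by rewrite (subsetP (quotient_cents C cTz)) // mem_quotient ?cycle_id.
have nilF := nilpotent_subnormal (Fitting_nil (W / C)) sYF.
have snY := subnormal_trans nilF (normal_subnormal (Fitting_normal (W / C))).
have := cosetpre_subnormal nsCW snY; rewrite /= quotientGK //.
by rewrite /normal sCA'.
Qed.

End PermutesDerived.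

(** * Derived subgroups of the factors are subnormal *)

Lemma mutually_permutable_quotient (gT : finGroupType) (A B N : {group gT}) :
    A \subset 'N(N) -> B \subset 'N(N) -> mutually_permutable A B ->
  mutually_permutable (A / N)%G (B / N)%G.
Proof. by move=> nNA nNB [pAB pBA]; split; apply: permutes_quotient. Qed.

Lemma perfect_solvable_quotient (gT : finGroupType) (G M : {group gT}) :
  [~: G, G] = G -> M <| G -> solvable (G / M) -> M :=: G.
Proof.
move=> perfG nsMG solQ; have [sMG nMG] := andP nsMG.
apply/eqP; rewrite eqEsubset sMG -quotient_sub1 //.
rewrite [G / M](perfect_solvable _ solQ) //=.
by rewrite -quotientR ?perfG.
Qed.

(* A' and B' are normal with N / A'B' solvable (Ito), so N = A'B' and A / A' permutes with all
   subgroups of N / A'. *)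
Lemma layer_mutually_permutable_normal (gT : finGroupType) (A B N : {group gT}) :
    layer N = N -> A * B = N -> mutually_permutable A B ->
  A^`(1) <|<| N -> B^`(1) <|<| N -> A <| N.
Proof.
move=> layN defN [pAB _] snA' snB'.
have perfN : [~: N, N] = N by rewrite -layN layer_perfect.
have nsA' := subnormal_layer_normal layN snA'.
have nsB' := subnormal_layer_normal layN snB'.
have sAN : A \subset N by rewrite -defN mulG_subl.
have sBN : B \subset N by rewrite -defN mulG_subr.
have nA'A : A \subset 'N(A^`(1)) := der_norm 1 A.
have nA'N := normal_norm nsA'.
have nA'B : B \subset 'N(A^`(1)) := subset_trans sBN nA'N.
have nsM : A^`(1) <*> B^`(1) <| N by rewrite normalY.
have defM : A^`(1) <*> B^`(1) = N.
  apply: (perfect_solvable_quotient perfN nsM).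
  have nMN := normal_norm nsM.
  apply: (@mulg_abelian_solvable _ (A / (A^`(1) <*> B^`(1)))%G (B / (A^`(1) <*> B^`(1)))%G).
  - by rewrite /= -quotientMl ?defN // (subset_trans sAN).
  - by rewrite sub_der1_abelian ?joing_subl.
  by rewrite sub_der1_abelian ?joing_subr.
have sNB : N / A^`(1) \subset B / A^`(1).
  rewrite -defM norm_joinEr ?(subset_trans (der_sub 1 B)) //.
  by rewrite quotientMidl quotientS ?der_sub.
have pAN : permutes_subgroups (A / A^`(1)) (N / A^`(1)).
  by apply: permutesS sNB _; apply: permutes_quotient.
have snQ := permutes_subnormal (quotientS _ sAN) pAN.
have := cosetpre_subnormal nsA' snQ; rewrite /= quotientGK ?der_normal //.
exact: subnormal_layer_normal.
Qed.

Lemma mutually_permutable_capN_minnormal (gT : finGroupType) (A B G N : {group gT}) :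
    A * B = G -> mutually_permutable A B -> minnormal N G -> N \subset G ->
  [/\ A :&: N = 1 & B :&: N = 1] \/ (A :&: N) * (B :&: N) = N.
Proof.
move=> defG mpAB /mingroupP[/andP[ntN nNG] minN] sNG.
have nsNG : N <| G by apply/andP.
have [nsM cM] := mutually_permutable_normal defG mpAB nsNG.
have defM : (A :&: N) <*> (B :&: N) = (A :&: N) * (B :&: N) by rewrite comm_joingE.
rewrite -defM in nsM *; have [M1|ntM] := eqVneq ((A :&: N) <*> (B :&: N)) 1.
  left; split; apply/trivgP; rewrite -M1 ?joing_subl ?joing_subr //.
right; apply: minN; rewrite ?ntM ?(normal_norm nsM) //.
by rewrite join_subG !subsetIr.
Qed.

Theorem mutually_permutable_der1_subnormal (gT : finGroupType) (A B G : {group gT}) :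
  A * B = G -> mutually_permutable A B -> A^`(1) <|<| G.
Proof.
have [m] := ubnP #|G|; elim: m gT A B G => // m IHm gT A B G ltGm defG mpAB.
have [pAB pBA] := mpAB.
have sAG : A \subset G by rewrite -defG mulG_subl.
have sBG : B \subset G by rewrite -defG mulG_subr.
have [G1|ntG] := eqVneq (gval G) 1.
  suff -> : A^`(1) = G by apply: subnormal_refl.
  apply/eqP; rewrite eqEsubset (subset_trans (der_sub 1 A)) //=.
  by rewrite G1 sub1G.
have [N minN sNG] : {N : {group gT} | minnormal N G & N \subset G}.
  by apply: mingroup_exists; rewrite ntG normG.
have /andP[ntN nNG] := mingroupp minN; have nsNG : N <| G by apply/andP.
have nNA := subset_trans sAG nNG; have nNB := subset_trans sBG nNG.
have snA'N : A^`(1) <*> N <|<| G.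
  have ltGN : #|G / N| < m by apply: leq_trans (ltn_quotient ntN sNG) _.
  have mpQ := mutually_permutable_quotient nNA nNB mpAB.
  have defGN : (A / N)%G * (B / N)%G = (G / N)%G by rewrite /= -quotientMl ?defG.
  have := IHm _ _ _ _ ltGN defGN mpQ; rewrite -quotient_der // => snQ.
  have := cosetpre_subnormal nsNG snQ; rewrite /= quotientYK 1?joingC //.
  exact: subset_trans (der_sub 1 A) nNA.
have nsA0N : A :&: N <| N.
  have [[-> _]|defN] := mutually_permutable_capN_minnormal defG mpAB minN sNG.
    exact: normal1.
  have [abN|abN] := boolP (abelian N); first by rewrite -sub_abelian_normal // subsetIr.
  have layN := minnormal_layer minN abN.
  have mp0 := mutually_permutable_capN N mpAB.
  have [eqNG|neqNG] := eqVneq (gval N) G; last first.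
    have ltNm : #|N| < m.
      by rewrite -ltnS; apply: leq_trans ltGm; rewrite ltnS proper_card // properEneq neqNG.
    have defN' : (B :&: N) * (A :&: N) = N by rewrite -(mp0.1 (B :&: N)%G (subxx _)).
    apply: (layer_mutually_permutable_normal layN defN mp0).
      exact: (IHm _ (A :&: N)%G (B :&: N)%G).
    exact: (IHm _ (B :&: N)%G (A :&: N)%G _ _ defN' (mutually_permutable_sym mp0)).
  have simG : simple G by move: minN; rewrite -[X in minnormal _ X]eqNG eqNG.
  have [AG|BG] := simple_mutually_permutable simG defG mpAB.
    by rewrite AG (setIidPr sNG) normal_refl.
  (* If [B] is all of [N], then [A] permutes with every subgroup of [N], so it is subnormal by Ore's
     theorem, hence normal. *)
  rewrite -eqNG in BG; have [_ pAN] := mutually_permutable_sym mpAB.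
  rewrite BG in pAN; have sAN : A \subset N by rewrite eqNG.
  by rewrite (setIidPl sAN); apply: subnormal_layer_normal layN (permutes_subnormal sAN pAN).
(* [A0] is known to be normal only in [AN], so [B] is cut down to [B1] before factoring [A0] out;
   Dedekind keeps [N] inside [A * B1]. *)
pose X := (A <*> N)%G; pose B1 := (B :&: X)%G; pose A0 := (A :&: N)%G.
have nsA0A : A0 <| A by rewrite /normal subsetIl normsI ?normG.
have nA0X : X \subset 'N(A0) by rewrite join_subG !normal_norm.
have [sAX sNX] := (joing_subl A N, joing_subr A N).
have nA0A := subset_trans sAX nA0X; have nA0N := subset_trans sNX nA0X.
have nA0B1 : B1 \subset 'N(A0) by rewrite (subset_trans (subsetIr _ _)).
have sNAB1 : N \subset A * B1.
  by rewrite group_modl // subsetI defG sNG.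
have tiA0 : (A / A0) :&: (N / A0) = 1.
  by rewrite -quotientIG ?subsetIr // quotientS1.
have pAB1 := permutes_quotient nA0A nA0B1 (permutesS (subsetIl B X) pAB).
have sNABb : N / A0 \subset (A / A0) * (B1 / A0).
  by rewrite -quotientMl // quotientS.
have nNAb : A / A0 \subset 'N(N / A0) by apply: quotient_norms.
have := permutes_der1_subnormal nNAb tiA0 sNABb pAB1.
have nA0A' := subset_trans (der_sub 1 A) nA0A.
have nsA0Y : A0 <| A^`(1) <*> N.
  rewrite /normal (subset_trans (subsetIr A N)) ?joing_subr // join_subG nA0A'.
  exact: nA0N.
rewrite -quotient_der // -quotientY // => /(cosetpre_subnormal nsA0Y).
rewrite /= quotientYK // => snY.
(* [snY] concerns the preimage [A0 A^](1)[, in which]A^[(1)] is normal because [A0] lies in [A]. *)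
apply: subnormal_trans (subnormal_trans snY snA'N); apply: normal_subnormal.
rewrite /normal joing_subr join_subG (subset_trans (normal_sub nsA0A)) ?der_norm //.
by rewrite normG.
Qed.

(** * Consequences of a subnormal derived subgroup *)

Section DerivedSubnormal.

Variables (gT : finGroupType) (A G : {group gT}).
Hypotheses (sAG : A \subset G) (snA' : A^`(1) <|<| G).

Lemma component_der1_subnormal (L : {group gT}) : component L A -> component L G.
Proof.
move=> cL; apply: (component_trans _ snA'); apply: (component_in cL _ (der_sub 1 A)).
by rewrite -(component_perfect cL) -derg1 dergS ?component_sub.
Qed.

Lemma layer_der1_subnormal : layer A \subset layer G.
Proof.
apply: layer_subP => [|L cL]; first exact: groupP.
exact/component_sub_layer/component_der1_subnormal.
Qed.

Lemma normal_der1_subnormal (X : {group gT}) : X <| A -> X :&: A^`(1) <|<| G.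
Proof.
move=> nsXA; apply: subnormal_trans snA'; apply: normal_subnormal.
rewrite /normal subsetIr normsI ?normG //.
exact: subset_trans (der_sub 1 A) (normal_norm nsXA).
Qed.

(** [[~: 'F(A), A]] is nilpotent and normal in [A], and it lies in
    [A^](1)[, so it is subnormal in]G[. Components of]A[are perfect, so they too lie in]A^[(1)] and
    are components of [G]. *)
Lemma Fstar_comm_sub : [~: Fstar A, A] \subset Fstar G.
Proof.
rewrite FstarE commMG; last first.
  by rewrite (subset_trans (layer_sub A)) ?commg_normr.
rewrite mul_subG //.
  rewrite (subset_trans _ (joing_subl _ _)) //.
  have sRA' : [~: 'F(A), A] \subset A^`(1) by rewrite derg1 commSg ?Fitting_sub.
  have sRF : [~: 'F(A), A] \subset 'F(A) by rewrite commg_subl gFnorm.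
  have nsRA : [~: 'F(A), A] <| A.
    by rewrite /normal commg_normr (subset_trans sRF) ?Fitting_sub.
  have := normal_der1_subnormal nsRA; rewrite (setIidPl sRA') => snR.
  exact: nilpotent_subnormal_Fitting snR (nilpotentS sRF (Fitting_nil A)).
rewrite (subset_trans _ (joing_subr _ _)) // (subset_trans _ layer_der1_subnormal) //.
by rewrite commg_subl layer_norm.
Qed.

(* A :&: F*(G) is the product of E(A) with a nilpotent normal subgroup of A. *)
Lemma cap_Fstar_sub : A :&: Fstar G \subset Fstar A.
Proof.
pose Q := (A :&: Fstar G)%G; pose Q1 := 'C_Q(layer A)%G.
have sQA : Q \subset A := subsetIl _ _.
have nsQA : Q <| A.
  by rewrite /normal sQA normsI ?normG // (subset_trans sAG) ?gFnorm.
have sQ1Q : Q1 \subset Q := subsetIl _ _.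
have nsQ1A : Q1 <| A.
  rewrite /normal (subset_trans sQ1Q sQA) normsI ?(normal_norm nsQA) //.
  by rewrite norms_cent ?layer_norm.
have sQ1F : Q1 \subset Fstar G := subset_trans sQ1Q (subsetIr _ _).
(* A component of [G] inside [A] is a component of [A]; any other one centralizes all components of
   [A]. *)
have sFEC : Fstar G \subset layer A * 'C_(Fstar G)(layer A).
  rewrite -norm_joinEr ?join_subG; last by rewrite cents_norm ?subsetIr.
  apply/andP; split.
    rewrite (subset_trans _ (joing_subr _ _)) // subsetI joing_subl /=.
    exact: subset_trans (Fitting_cent_layer G) (centS layer_der1_subnormal).
  apply: layer_subP => [|L cL]; first exact: groupP.
  have [sLA|not_sLA] := boolP (L \subset A).
    by rewrite (subset_trans _ (joing_subl _ _)) // component_sub_layer // (component_in cL).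
  rewrite (subset_trans _ (joing_subr _ _)) // subsetI.
  rewrite (subset_trans (component_sub_layer cL)) ?joing_subr //= centsC.
  apply: layer_subP => [|M cM]; first exact: groupP.
  apply: component_cents (component_der1_subnormal cM) cL _.
  by apply: contraNneq not_sLA => <-; apply: component_sub.
have sQ : Q \subset layer A * Q1.
  have -> : Q1 = 'C_(Fstar G)(layer A) :&: A :> {set gT} by rewrite /= -setIA setIC.
  by rewrite group_modl ?layer_sub // subsetI sQA andbT (subset_trans (subsetIr _ _) sFEC).
suff nilQ1 : nilpotent Q1.
  apply: subset_trans sQ _; rewrite mul_subG ?joing_subr //.
  by rewrite (subset_trans (Fitting_max nsQ1A nilQ1)) ?joing_subl.
(* This subnormal subgroup contains no component of [G], which would lie in [layer A] and centralize
   itself; so it centralizes [layer G]. *)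
have sSF : Q1 :&: A^`(1) \subset 'F(G).
  apply: subset_trans (cent_layer_Fstar G); rewrite subsetI (subset_trans (subsetIl _ _)) //=.
  rewrite centsC; apply: layer_subP => [|L cL]; first exact: groupP.
  have [sLS|/commG1P //] := component_subnormal cL (normal_der1_subnormal nsQ1A).
  case/negP: (component_nonabelian cL).
  have sLQ1 := subset_trans sLS (subsetIl _ _).
  have sLE : L \subset layer A.
    by rewrite component_sub_layer // (component_in cL) // (subset_trans sLQ1) ?normal_sub.
  by apply: subset_trans sLQ1 (subset_trans (subsetIr _ _) (centS sLE)).
have lcnF n : 'L_n.+2(Q1) \subset 'L_n.+1('F(G)).
  elim: n => [|n IHn].
    rewrite lcn2 lcn1; apply: subset_trans sSF.
    by rewrite subsetI der_sub dergS ?normal_sub.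
  rewrite lcnSn [in X in _ \subset X]lcnSn (subset_trans (commgSS IHn sQ1F)) //.
  set K := 'L_n.+1('F(G)); have sKF : K \subset 'F(G) := lcn_sub _ _.
  have cEK : layer G \subset 'C(K).
    by rewrite centsC (subset_trans sKF) ?Fitting_cent_layer.
  have cEFK : layer G \subset 'C([~: 'F(G), K]).
    rewrite centsC (subset_trans _ (Fitting_cent_layer G)) //.
    by rewrite (subset_trans (commgS _ sKF)) ?der_sub // -derg1 der_sub.
  rewrite FstarE commGC commMG ?cents_norm // (commG1P cEK) mulg1 commGC.
  exact: subxx.
have /lcnP[n Fn1] := Fitting_nil G.
apply/lcnP; exists n.+1; apply/trivgP; rewrite -Fn1; exact: lcnF.
Qed.

End DerivedSubnormal.

(** * Quasinilpotent factors *)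

Lemma layer_id (gT : finGroupType) (G : {group gT}) : layer (layer G) = layer G.
Proof.
apply/eqP; rewrite eqEsubset layer_sub /=.
apply: layer_subP => [|L cL]; first exact: groupP.
exact: component_sub_layer (component_in cL (component_sub_layer cL) (layer_sub G)).
Qed.

Section LayerProduct.

Variables (gT : finGroupType) (A B G : {group gT}).
Hypotheses (defG : A * B = G) (mpAB : mutually_permutable A B).

Let sAG : A \subset G. Proof. by rewrite -defG mulG_subl. Qed.
Let sBG : B \subset G. Proof. by rewrite -defG mulG_subr. Qed.

Let defG' : B * A = G. Proof. by rewrite -defG (mpAB.1 B). Qed.

Let snA' : A^`(1) <|<| G.
Proof. exact: mutually_permutable_der1_subnormal defG mpAB. Qed.

Let snB' : B^`(1) <|<| G.
Proof. exact: mutually_permutable_der1_subnormal defG' (mutually_permutable_sym mpAB). Qed.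

Local Notation E := (layer G).

(* G modulo the centralizer of the components outside (A :&: E)(B :&: E) is a product of two
   abelian groups, hence solvable; so there are no such components. *)
Lemma mulg_cap_layer : (A :&: E) * (B :&: E) = E.
Proof.
have [nsM cM] := mutually_permutable_normal defG mpAB (layer_normal G).
pose M := ((A :&: E) <*> (B :&: E))%G.
have defM : M = (A :&: E) * (B :&: E) :> {set gT} by rewrite /= comm_joingE.
rewrite -defM in nsM *; apply/eqP; rewrite eqEsubset join_subG !subsetIr /=.
apply: layer_subP => [|L cL]; first exact: groupP.
apply: contraT => not_sLM.
pose Z := \bigcup_(X : {set gT} | component X G && ~~ (X \subset M)) X.
pose C := 'C_G(Z)%G.
have cZ (K : {group gT}) : K^`(1) <|<| G -> K :&: E \subset M -> K^`(1) \subset 'C(Z).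
  move=> snK sKEM; rewrite centsC; apply/bigcupsP=> X /andP[cX]; have [L1 defX _] := componentP cX.
  rewrite defX in cX * => not_sL1M.
  have [sL1K|/commG1P//] := component_subnormal cX snK.
  case/negP: not_sL1M; apply: subset_trans sKEM.
  by rewrite subsetI (subset_trans sL1K) ?der_sub ?component_sub_layer.
have nZG : G \subset 'N(Z).
  apply/subsetP=> x Gx; rewrite inE; apply/subsetP=> _ /imsetP[z /bigcupP[X /andP[cX not_sXM] Xz] ->].
  have [L1 defX _] := componentP cX; apply/bigcupP; exists (X :^ x); last by rewrite memJ_conjg.
  rewrite {1}defX componentJ -?defX //=; apply: contra not_sXM => sXxM.
  by rewrite -(conjSg _ _ x) (normsP (normal_norm nsM) x Gx).
have nsCG : C <| G by rewrite /normal subsetIl normsI ?normG ?norms_cent.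
have solQ : solvable (G / C).
  have nCG := normal_norm nsCG.
  apply: (@mulg_abelian_solvable _ (A / C)%G (B / C)%G).
  - by rewrite /= -quotientMl ?defG // (subset_trans sAG).
  - rewrite sub_der1_abelian // subsetI (subset_trans (der_sub 1 A)) // cZ //.
    exact: joing_subl.
  rewrite sub_der1_abelian // subsetI (subset_trans (der_sub 1 B)) // cZ //.
  exact: joing_subr.
have sLG := component_sub cL; have nCL := subset_trans sLG (normal_norm nsCG).
have sLC : L \subset C.
  rewrite -quotient_sub1 // [L / C](perfect_solvable _ (solvableS (quotientS _ sLG) solQ)) //.
  by rewrite -quotientR // (component_perfect cL).
have sLZ : L \subset Z by rewrite (bigcup_max (gval L)) // cL.
case/negP: (component_nonabelian cL); rewrite /abelian.
by apply: subset_trans sLC (subset_trans (subsetIr _ _) (centS sLZ)).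
Qed.

Lemma cap_layer_normal : A :&: E <| E.
Proof.
have mp0 := mutually_permutable_capN E mpAB.
have sn (K : {group gT}) : K \subset G -> K^`(1) <|<| G -> (K :&: E)^`(1) <|<| E.
  move=> sKG snK; have nsKE : K :&: E <| K.
    by rewrite /normal subsetIl normsI ?normG // (subset_trans sKG) ?layer_norm.
  have := normal_der1_subnormal snK (char_normal_trans (der_char 1 (K :&: E)%G) nsKE).
  have sd : (K :&: E)^`(1) \subset K^`(1) by rewrite dergS ?subsetIl.
  rewrite (setIidPl sd) => snd; have := setI_subnormal (layer_sub G) snd.
  by rewrite (setIidPl _) // (subset_trans (der_sub 1 _)) ?subsetIr.
by apply: (layer_mutually_permutable_normal (layer_id G) mulg_cap_layer mp0); apply: sn.
Qed.

End LayerProduct.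

Section LayerAction.

Variables (gT : finGroupType) (A B G : {group gT}).
Hypotheses (defG : A * B = G) (mpAB : mutually_permutable A B).

Local Notation E := (layer G).

Lemma mutually_permutable_mulgC : B * A = G.
Proof. by rewrite -defG (mpAB.1 B). Qed.

Let mpBA : mutually_permutable B A := mutually_permutable_sym mpAB.

(** A component in neither factor centralizes both [A :&: E] and [B :&: E], hence their product [E],
    hence itself. *)
Lemma component_sub_factor (L : {group gT}) :
  component L G -> L \subset A \/ L \subset B.
Proof.
move=> cL; have sLE := component_sub_layer cL.
have cLE := component_in cL sLE (layer_sub G).
have [|/commG1P cLA] := component_normal cLE (cap_layer_normal defG mpAB).
  by rewrite subsetI => /andP[]; left.
have [|/commG1P cLB] := component_normal cLE (cap_layer_normal mutually_permutable_mulgC mpBA).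
  by rewrite subsetI => /andP[]; right.
case/negP: (component_nonabelian cL); rewrite /abelian.
apply: subset_trans sLE _; rewrite -(mulg_cap_layer defG mpAB) mul_subG //.
  by rewrite centsC.
by rewrite centsC.
Qed.

(* If L is not in A then AL :&: E = (A :&: E)L is A-invariant and L is its only component outside A. *)
Lemma component_factor_norm (L : {group gT}) :
  component L G -> ~~ (L \subset A) -> A \subset 'N(L).
Proof.
move=> cL not_sLA; have sLE := component_sub_layer cL.
have sLB : L \subset B by case: (component_sub_factor cL) not_sLA => [->|].
have sAG : A \subset G by rewrite -defG mulG_subl.
have [pAB pBA] := mpAB.
have nP : A \subset 'N((A <*> L) :&: E).
  by rewrite (permutes_cap_norm pAB) // (subset_trans sAG) ?layer_norm.
have defP : (A <*> L) :&: E = (A :&: E) * L.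
  by rewrite (permutes_joing pAB) // (setIC A) group_modr // setIC.
apply/subsetP=> a Aa; have Ga := subsetP sAG a Aa.
have cLa := componentJ Ga cL.
have sLaE : L :^ a \subset E := component_sub_layer cLa.
have not_sLaA : ~~ (L :^ a \subset A) by rewrite -{1}(conjGid Aa) conjSg.
have sLaP : L :^ a \subset (A :&: E) * L.
  rewrite -defP -(normsP nP a Aa) conjSg subsetI sLE joing_subr //.
have [eqLa|neqLa] := eqVneq (L :^ a)%G L.
  by rewrite inE -[L :^ a]/(gval (L :^ a)%G) eqLa.
have cLLa : L \subset 'C(L :^ a).
  by rewrite centsC; apply: (component_cents (L1 := (L :^ a)%G) cLa cL).
have cLaE := component_in cLa sLaE (layer_sub G).
have cALa : A :&: E \subset 'C(L :^ a).
  have [|/commG1P cLaA] := component_normal cLaE (cap_layer_normal defG mpAB).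
    by rewrite subsetI (negPf not_sLaA).
  by rewrite centsC.
case/negP: (component_nonabelian (L := (L :^ a)%G) cLa).
by apply: subset_trans sLaP _; rewrite mul_subG.
Qed.

Lemma Fitting_factor_cent_component (L : {group gT}) :
  component L G -> L \subset A -> 'F(A) \subset 'C(L).
Proof.
have sAG : A \subset G by rewrite -defG mulG_subl.
move=> cL sLA; apply: subset_trans (Fitting_cent_layer A) (centS _).
by rewrite component_sub_layer // (component_in cL).
Qed.

Lemma Fitting_factor_norm_component (L : {group gT}) :
  component L G -> 'F(A) \subset 'N(L).
Proof.
move=> cL; have [sLA|not_sLA] := boolP (L \subset A).
  by rewrite cents_norm // Fitting_factor_cent_component.
by rewrite (subset_trans (Fitting_sub A)) // component_factor_norm.
Qed.

Lemma Fitting_factor_der1 : 'F(A)^`(1) \subset 'C(E).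
Proof.
have snA' := mutually_permutable_der1_subnormal defG mpAB.
rewrite centsC; apply: layer_subP => [|L cL]; first exact: groupP.
have [sLA|not_sLA] := boolP (L \subset A).
  by rewrite centsC (subset_trans (der_sub 1 _)) ?Fitting_factor_cent_component.
have [sLA'|/commG1P cLA'] := component_subnormal cL snA'.
  by case/negP: not_sLA; rewrite (subset_trans sLA') ?der_sub.
by rewrite centsC (subset_trans (dergS 1 (Fitting_sub A))) // centsC.
Qed.

End LayerAction.

(** Modulo [K] the factors are the images of ['F(A)] and ['F(B)], which are abelian. These commute:
    on each component both act, and the Fitting subgroup of the factor containing it acts
    trivially. *)
Lemma layer_cent_der1 (gT : finGroupType) (A B G : {group gT}) :
    A * B = G -> mutually_permutable A B -> Fstar A = A -> Fstar B = B ->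
  G^`(1) \subset layer G <*> 'C_G(layer G).
Proof.
move=> defG mpAB FA FB; have defGr := mutually_permutable_mulgC defG mpAB.
have mpBA := mutually_permutable_sym mpAB.
have sAG : A \subset G by rewrite -defG mulG_subl.
have sBG : B \subset G by rewrite -defG mulG_subr.
have snA' := mutually_permutable_der1_subnormal defG mpAB.
have snB' := mutually_permutable_der1_subnormal defGr mpBA.
set K := layer G <*> 'C_G(layer G).
have nsK : K <| G.
  by rewrite normalY ?layer_normal // /normal subsetIl normsI ?normG ?norms_cent ?layer_norm.
have sCK (X : {group gT}) : X \subset G -> X \subset 'C(layer G) -> X \subset K.
  by move=> sXG cX; rewrite (subset_trans _ (joing_subr _ _)) // subsetI sXG.
have nKG := normal_norm nsK.
have sFG (X : {group gT}) : X \subset G -> 'F(X) \subset G.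
  by move=> sXG; rewrite (subset_trans (Fitting_sub X)).
have quoF (X : {group gT}) : X \subset G -> X^`(1) <|<| G -> Fstar X = X -> X / K \subset 'F(X) / K.
  move=> sXG snX' FX; rewrite -{1}FX FstarE quotientMl ?(subset_trans (sFG X sXG)) //.
  rewrite [layer X / K]quotientS1 ?mulg1 //.
  by rewrite (subset_trans (layer_der1_subnormal snX')) ?joing_subl.
have cFF : [~: 'F(A), 'F(B)] \subset K.
  apply: sCK; first by rewrite (subset_trans (commgSS (sFG A sAG) (sFG B sBG))) // -derg1 der_sub.
  rewrite centsC; apply: layer_subP => [|L cL]; first exact: groupP.
  rewrite centsC.
  have nAL := Fitting_factor_norm_component defG mpAB cL.
  have nBL := Fitting_factor_norm_component defGr mpBA cL.
  have [sLA|sLB] := component_sub_factor defG mpAB cL.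
    have cAL := Fitting_factor_cent_component defG cL sLA.
    by rewrite (subset_trans (commgSS cAL nBL)) // commg_subl cent_norm.
  have cBL := Fitting_factor_cent_component defGr cL sLB.
  by rewrite (subset_trans (commgSS nAL cBL)) // commg_subr cent_norm.
have defQ : G / K = (A / K) * (B / K).
  by rewrite -quotientMl ?defG // (subset_trans sAG).
suff abQ : abelian (G / K) by apply: der1_min.
rewrite defQ; apply: (abelianS (mulgSS (quoF A sAG snA' FA) (quoF B sBG snB' FB))).
rewrite abelianM.
have -> /= : abelian ('F(A) / K).
  rewrite sub_der1_abelian // sCK ?(Fitting_factor_der1 defG mpAB) //.
  by rewrite (subset_trans (der_sub 1 _)) ?sFG.
have -> /= : abelian ('F(B) / K).
  rewrite sub_der1_abelian // sCK ?(Fitting_factor_der1 defGr mpBA) //.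
  by rewrite (subset_trans (der_sub 1 _)) ?sFG.
by rewrite centsC quotient_cents2r.
Qed.

(** * Action on an abelian minimal normal subgroup *)

Section MinnormalAction.

Variable gT : finGroupType.
Implicit Types (A B G K N P S T Y : {group gT}).

(** On [N / A0] the chain argument applies, since a section of order [p] has only [p.-1]
    automorphisms; the action on [A0] is trivial by hypothesis, and coprimeness joins the two. *)
Lemma permutes_coprime_cent A B N Y p :
    A \subset 'N(N) -> abelian N -> prime p -> p.-group N -> N \subset A * B ->
    permutes_subgroups A B -> Y \subset A -> p^'.-group Y -> coprime #|Y| p.-1 ->
    Y \subset 'C(A :&: N) ->
  Y \subset 'C(N).
Proof.
move=> nNA abN prp pN sNAB pAB sYA p'Y coY cY0.
pose X := (A <*> N)%G; pose B1 := (B :&: X)%G; pose A0 := (A :&: N)%G.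
have nsA0N : A0 <| N by rewrite -sub_abelian_normal ?subsetIr.
have nsA0A : A0 <| A by rewrite /normal subsetIl normsI ?normG.
have nA0X : X \subset 'N(A0) by rewrite join_subG !normal_norm.
have [sAX sNX] := (joing_subl A N, joing_subr A N).
have nA0A := subset_trans sAX nA0X; have nA0N := subset_trans sNX nA0X.
have nA0B1 : B1 \subset 'N(A0) by rewrite (subset_trans (subsetIr _ _)).
have nA0Y := subset_trans sYA nA0A.
have sNAB1 : N \subset A * B1 by rewrite group_modl // subsetI sNAB.
have tiA0 : (A / A0) :&: (N / A0) = 1 by rewrite -quotientIG ?subsetIr // quotientS1.
have pAB1 := permutes_quotient nA0A nA0B1 (permutesS (subsetIl B X) pAB).
have sNABb : N / A0 \subset (A / A0) * (B1 / A0) by rewrite -quotientMl // quotientS.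
have nNAb : A / A0 \subset 'N(N / A0) by apply: quotient_norms.
have [S [pS sSB1 sSAN sylT]] := permutes_Sylow nNAb tiA0 sNABb pAB1 prp.
have sYAb := quotientS A0 sYA.
have p'Yb : p^'.-group (Y / A0) by apply: quotient_pgroup.
have [|_] := permutes_chain nNAb tiA0 prp pS sSAN (permutesS sSB1 pAB1) sYAb p'Yb.
  move=> T U nTA nUA nsUT indTU; apply: coprime_prime_section; rewrite ?indTU //.
  - exact: subset_trans sYAb nTA.
  - exact: subset_trans sYAb nUA.
  exact: coprime_dvdl (dvdn_quotient _ _) coY.
rewrite (pHall_id sylT (quotient_pgroup A0 pN)) centsC quotient_cents2 // => sNYA0.
apply: (stable_coprime_cents nsA0N) => //; first exact: abelian_sol.
exact: pnat_coprime pN p'Y.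
Qed.

Lemma minnormal_cent_Fstar N G :
  minnormal N G -> N \subset G -> abelian N -> Fstar G \subset 'C(N).
Proof.
move=> minN sNG abN; have /mingroupP[/andP[ntN nNG] minNG] := minN.
have nsNG : N <| G by apply/andP.
have sNF : N \subset 'F(G) by rewrite Fitting_max // abelian_nil.
rewrite join_subG; apply/andP; split; last first.
  by rewrite centsC (subset_trans sNF) ?Fitting_cent_layer.
have nsZ : 'Z('F(G)) <| G := gFnormal_trans _ (Fitting_normal G).
have ntNZ : N :&: 'Z('F(G)) != 1.
  exact: meet_center_nil (Fitting_nil G) (normalS sNF (Fitting_sub G) nsNG) ntN.
have eqNZ : N :&: 'Z('F(G)) = N.
  by apply: minNG; rewrite ?subsetIl // ntNZ normsI ?normal_norm.
by rewrite centsC -eqNZ (subset_trans (subsetIr _ _)) // subsetIr.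
Qed.

(** The preimage [K] is ['C_G(N)] times a [p]-group, which has nontrivial fixed points on [N]; so
    ['C_N(K)] is nontrivial and normal in [G], hence all of [N]. *)
Lemma minnormal_pcore_quotient_cent N G (p : nat) :
  minnormal N G -> p.-group N -> N \subset G -> 'O_p(G / 'C_G(N)) = 1.
Proof.
move=> minN pN sNG; have /mingroupP[/andP[ntN nNG] minNG] := minN.
set C := 'C_G(N); have nsC : C <| G by rewrite /normal subsetIl normsI ?normG ?norms_cent.
have nCG := normal_norm nsC.
pose K := (coset C @*^-1 'O_p(G / C))%G.
have nsKG : K <| G by rewrite -(quotientGK nsC) cosetpre_normal pcore_normal.
have sKG := normal_sub nsKG; have nCK := subset_trans sKG nCG.
have sCK : C \subset K by apply: sub_cosetpre.
have [P sylP] := Sylow_exists p K; have sPK := pHall_sub sylP.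
have pP := pHall_pgroup sylP; have sPG := subset_trans sPK sKG.
have nNP := subset_trans sPG nNG.
have defK : K \subset C * P.
  rewrite -quotientSK //.
  have sylPC : p.-Sylow(K / C) (P / C) by apply: quotient_pHall; rewrite ?(subset_trans sPK).
  by rewrite (pHall_id sylPC) //= cosetpreK pcore_pgroup.
have ntNP : 'C_N(P) != 1.
  have pNP : p.-group (N <*> P) by rewrite norm_joinEr // pgroupM pN.
  have nsNNP : N <| N <*> P by rewrite /normal joing_subl join_subG normG.
  have ntZ := meet_center_nil (pgroup_nil pNP) nsNNP ntN.
  apply: contraNneq ntZ => C1; rewrite -subG1 -C1 setIS //.
  by rewrite (subset_trans (subsetIr _ _)) // centS ?joing_subr.
have eqCP : 'C_N(P) \subset 'C_N(K).
  rewrite subsetI subsetIl centsC (subset_trans defK) // mul_subG //.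
    by rewrite centsC (subset_trans (subsetIl _ _)) // centsC subsetIr.
  by rewrite centsC subsetIr.
have ntNK : 'C_N(K) != 1.
  by rewrite -subG1; apply: contra ntNP => CK1; rewrite -subG1 (subset_trans eqCP).
have eqNK : 'C_N(K) = N.
  by apply: minNG; rewrite ?subsetIl // ntNK normsI // norms_cent // normal_norm.
have sKC : K \subset C by rewrite subsetI sKG centsC -eqNK subsetIr.
by have := quotientS1 sKC; rewrite /= cosetpreK.
Qed.

Lemma index_p'group_quotient (p : nat) (A C : {group gT}) :
    A \subset 'N(C) ->
    (forall Y : {group gT}, Y \subset A -> p.-group Y -> Y \subset C) ->
  p^'.-group (A / C).
Proof.
move=> nCA sYC; have [P sylP] := Sylow_exists p A.
have sPA := pHall_sub sylP; rewrite /pgroup card_quotient //.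
apply: (@pnat_dvd _ #|A : P|); last by case/and3P: sylP.
by rewrite -indexgI indexgS // subsetI sPA sYC ?(pHall_pgroup sylP).
Qed.

Lemma pgroup_sub_p'quotient (pi : nat_pred) (Y C : {group gT}) :
  Y \subset 'N(C) -> pi.-group Y -> pi^'.-group (Y / C) -> Y \subset C.
Proof.
move=> nCY pY p'YC; rewrite -quotient_sub1 // subG1 trivg_card1.
by apply/eqP; apply: (@pnat_1 pi); [apply: quotient_pgroup | apply: p'YC].
Qed.

Lemma pgroup_mulg_quotient (pi : nat_pred) (A B C : {group gT}) G :
    A * B = G -> G \subset 'N(C) -> pi.-group (A / C) -> pi.-group (B / C) ->
  pi.-group (G / C).
Proof.
move=> defG nCG piA piB; have sAG : A \subset G by rewrite -defG mulG_subl.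
have defQ : (G / C) = (A / C) * (B / C).
  by rewrite -quotientMl ?defG // (subset_trans sAG).
rewrite /pgroup (@pnat_dvd _ (#|A / C| * #|B / C|)) //; last by rewrite pnatM; apply/andP.
by rewrite defQ mul_cardG dvdn_mulr.
Qed.

End MinnormalAction.

(** If a minimal normal subgroup [N] is an [r]-group with [r < p], then [p] does not divide [r.-1],
    so the [p]-subgroups of both factors, and then of [G], centralize [N]. A Sylow [p]-subgroup of
    the preimage of ['O_p(G / N)] is therefore normal in it. *)
Lemma abelian_product_pcore (gT : finGroupType) (A B G : {group gT}) (p : nat) :
    A * B = G -> mutually_permutable A B -> abelian A -> abelian B -> prime p ->
    {in \pi(G), forall q, q <= p} -> p %| #|G| ->
  'O_p(G) != 1.
Proof.
have [m] := ubnP #|G|; elim: m gT A B G => // m IHm gT A B G ltGm defG mpAB abA abB prp leqp pG.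
have [pAB pBA] := mpAB; have defGr : B * A = G by rewrite -defG (pAB B).
have sAG : A \subset G by rewrite -defG mulG_subl.
have sBG : B \subset G by rewrite -defG mulG_subr.
have solG := mulg_abelian_solvable defG abA abB.
have ntG : G :!=: 1.
  by apply: contraTneq pG => ->; rewrite cards1 dvdn1; case: eqP prp => // ->.
have [N minN sNG] : {N : {group gT} | minnormal N G & N \subset G}.
  by apply: mingroup_exists; rewrite ntG normG.
have /andP[ntN nNG] := mingroupp minN; have nsNG : N <| G by apply/andP.
have [_ _ /is_abelemP[r prr abelN]] := minnormal_solvable minN sNG solG.
have [rN abN _] := and3P abelN.
have [eqrp | neqrp] := eqVneq r p.
  apply: contraNneq ntN => O1; rewrite -subG1 -O1 pcore_max //; rewrite -eqrp //.
have rG : r \in \pi(G).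
  rewrite mem_primes prr cardG_gt0 /=; have [_ rdv _] := pgroup_pdiv rN ntN.
  exact: dvdn_trans rdv (cardSg sNG).
have ltrp : r < p by rewrite ltn_neqAle neqrp leqp.
pose C := 'C_G(N)%G.
have nsCG : C <| G by rewrite /normal subsetIl normsI ?normG ?norms_cent.
have nCG := normal_norm nsCG.
have sYC (A1 B1 Y : {group gT}) : A1 * B1 = G -> mutually_permutable A1 B1 ->
    abelian A1 -> Y \subset A1 -> p.-group Y -> Y \subset C.
  move=> defG1 [pA1B1 _] abA1 sYA1 pY; have sA1G : A1 \subset G by rewrite -defG1 mulG_subl.
  rewrite subsetI (subset_trans sYA1) //=.
  apply: (permutes_coprime_cent (A := A1) (B := B1) (p := r)) => //.
  - exact: subset_trans sA1G nNG.
  - by rewrite defG1.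
  - by apply: pi_pgroup pY _; rewrite !inE eq_sym.
  - have [k ->] := p_natP pY; rewrite coprimeXl // prime_coprime //.
    rewrite gtnNdvd //; last by rewrite prednK ?prime_gt0 // ltnW // ltnW.
    by rewrite -subn1 subn_gt0 prime_gt1.
  by rewrite (subset_trans sYA1) // (subset_trans abA1) // centS ?subsetIl.
have p'GC : p^'.-group (G / C).
  apply: (pgroup_mulg_quotient defG nCG); apply: index_p'group_quotient.
  - exact: subset_trans sAG nCG.
  - by move=> Y; apply: (sYC A B).
  - exact: subset_trans sBG nCG.
  by move=> Y; apply: (sYC B A) => //; apply: mutually_permutable_sym.
have sPC (Y : {group gT}) : Y \subset G -> p.-group Y -> Y \subset 'C(N).
  move=> sYG pY; suff : Y \subset C by rewrite subsetI => /andP[].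
  apply: (pgroup_sub_p'quotient (subset_trans sYG nCG) pY).
  exact: pgroupS (quotientS _ sYG) p'GC.
have pGN : p %| #|G / N|.
  move: pG; rewrite -(Lagrange sNG) -card_quotient // Euclid_dvdM // => /orP[pN|//].
  by have := pgroupP rN p prp pN; rewrite inE /= eq_sym (negPf neqrp).
have ltGN : #|G / N| < m by apply: leq_trans (ltn_quotient ntN sNG) _.
have ntO : 'O_p(G / N) != 1.
  have nNA := subset_trans sAG nNG; have nNB := subset_trans sBG nNG.
  apply: (IHm _ (A / N)%G (B / N)%G) => //.
  - by rewrite /= -quotientMl ?defG.
  - exact: mutually_permutable_quotient.
  - exact: quotient_abelian.
  - exact: quotient_abelian.
  move=> q; rewrite mem_primes => /and3P[prq _ qdv]; apply: leqp.
  by rewrite mem_primes prq cardG_gt0 (dvdn_trans qdv) ?dvdn_quotient.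
pose K := (coset N @*^-1 'O_p(G / N))%G.
have nsKG : K <| G by rewrite -(quotientGK nsNG) cosetpre_normal pcore_normal.
have sKG := normal_sub nsKG; have nNK := subset_trans sKG nNG.
have sNK : N \subset K by apply: sub_cosetpre.
have [P sylP] := Sylow_exists p K; have sPK := pHall_sub sylP.
have pP := pHall_pgroup sylP.
have sPN : P \subset 'N(N) := subset_trans sPK nNK.
have defKN : P / N = 'O_p(G / N).
  have sylPN : p.-Sylow(K / N) (P / N) by apply: quotient_pHall.
  by rewrite (pHall_id sylPN) /= cosetpreK // pcore_pgroup.
have defK : K \subset N * P.
  by rewrite -quotientSK // defKN /= cosetpreK.
have nPK : K \subset 'N(P).
  rewrite (subset_trans defK) // mulG_subG normG andbT cents_norm // centsC sPC //.
  exact: subset_trans sPK sKG.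
have sPO : P \subset 'O_p(G).
  have nsPK : P <| K by apply/andP.
  rewrite (subset_trans (pcore_max pP nsPK)) // pcore_max ?pcore_pgroup //.
  exact: gFnormal_trans.
apply: contraNneq ntO => O1; rewrite -defKN -subG1 quotient_sub1 //.
by rewrite (subset_trans sPO) // O1 sub1G.
Qed.

Section AbelianMinnormal.

Variable gT : finGroupType.
Implicit Types (A B G K N P S T Y : {group gT}).

(** [A :&: N] lies in ['O_p('F(A))], so ['O_p^'('F(A))] and [layer A] centralize it, and [A] acts on
    it as a [p]-group. *)
Lemma quasinilpotent_cap_cent A N Y (p : nat) :
    Fstar A = A -> A \subset 'N(N) -> abelian N -> p.-group N ->
    Y \subset A -> p^'.-group Y ->
  Y \subset 'C(A :&: N).
Proof.
move=> FA nNA abN pN sYA p'Y.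
have nsA0 : A :&: N <| A by rewrite /normal subsetIl normsI ?normG.
have pA0 : p.-group (A :&: N) by apply: pgroupS pN; apply: subsetIr.
have abA0 : abelian (A :&: N) by apply: abelianS abN; apply: subsetIr.
have sA0F : A :&: N \subset 'F(A) by rewrite Fitting_max // abelian_nil.
have sA0O : A :&: N \subset 'O_p('F(A)).
  by rewrite pcore_max // (normalS sA0F (Fitting_sub A)).
pose C := 'C_A(A :&: N)%G.
have nCA : A \subset 'N(C) by rewrite normsI ?normG ?norms_cent ?normal_norm.
have [_ defF cOO _] := dprodP (nilpotent_pcoreC p (Fitting_nil A)).
have sEC : layer A \subset C.
  by rewrite subsetI layer_sub centsC (subset_trans sA0F) ?Fitting_cent_layer.
have sOC : 'O_p^'('F(A)) \subset C.
  rewrite subsetI gFsub_trans ?Fitting_sub //= (subset_trans cOO) //.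
  exact: centS sA0O.
have sAOC : A \subset 'O_p('F(A)) * C.
  have : 'F(A) * layer A \subset 'O_p('F(A)) * C.
    by rewrite -[X in X * _]defF -mulgA mulgS // mul_subG.
  by rewrite -FstarE FA.
have pAC : p.-group (A / C).
  have sAOq : A / C \subset 'O_p('F(A)) / C
    by have := quotientS C sAOC; rewrite quotientMidr.
  by rewrite (pgroupS sAOq) // quotient_pgroup ?pcore_pgroup.
have : Y \subset C; last by rewrite subsetI => /andP[].
apply: (pgroup_sub_p'quotient (pi := p^')) => //; first exact: subset_trans nCA.
by rewrite pgroupNK (pgroupS _ pAC) ?quotientS.
Qed.

Lemma minnormal_dvd_leq A B G N (p : nat) :
    A * B = G -> mutually_permutable A B -> Fstar A = A -> abelian N -> p.-group N ->
    prime p -> N <| G ->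
  {in \pi(A / 'C_G(N)), forall q, q <= p}.
Proof.
move=> defG [pAB _] FA abN pN prp nsNG q; have [sNG nNG] := andP nsNG.
have sAG : A \subset G by rewrite -defG mulG_subl.
set C := 'C_G(N); have nCG : G \subset 'N(C) by rewrite normsI ?normG ?norms_cent.
have nCA := subset_trans sAG nCG; have nNA := subset_trans sAG nNG.
rewrite mem_primes => /and3P[prq _ qdv]; rewrite leqNgt; apply/negP=> ltpq.
suff : q^'.-group (A / C) by rewrite /pgroup p'natE // qdv.
apply: (@index_p'group_quotient _ q A C%G) => // Y sYA qY.
have p'Y : p^'.-group Y.
  by apply: pi_pgroup qY _; rewrite !inE eq_sym neq_ltn ltpq.
rewrite subsetI (subset_trans sYA) //=.
apply: (permutes_coprime_cent (A := A) (B := B) (p := p)) => //.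
- by rewrite defG.
- have [k ->] := p_natP qY; rewrite coprimeXl // prime_coprime //.
  have p1gt0 : 0 < p.-1 by rewrite -subn1 subn_gt0 prime_gt1.
  by rewrite gtnNdvd // (leq_ltn_trans (leq_pred p)).
exact: quasinilpotent_cap_cent pN sYA p'Y.
Qed.

Lemma minnormal_p'quotient A B G N (p : nat) :
    A * B = G -> mutually_permutable A B -> Fstar A = A -> Fstar B = B ->
    minnormal N G -> N \subset G -> abelian N -> p.-group N -> prime p ->
  [/\ A^`(1) \subset 'C_G(N), B^`(1) \subset 'C_G(N) & p^'.-group (G / 'C_G(N))].
Proof.
move=> defG mpAB FA FB minN sNG abN pN prp.
have defGr := mutually_permutable_mulgC defG mpAB.
have mpBA := mutually_permutable_sym mpAB.
have sAG : A \subset G by rewrite -defG mulG_subl.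
have sBG : B \subset G by rewrite -defG mulG_subr.
have /andP[ntN nNG] := mingroupp minN; have nsNG : N <| G by apply/andP.
have sFC : Fstar G \subset 'C_G(N).
  by rewrite subsetI Fstar_sub (minnormal_cent_Fstar minN).
have der (A1 B1 : {group gT}) : A1 * B1 = G -> mutually_permutable A1 B1 ->
    Fstar A1 = A1 -> A1^`(1) \subset 'C_G(N).
  move=> defG1 mp1 FA1; apply: subset_trans sFC.
  have := Fstar_comm_sub (mutually_permutable_der1_subnormal defG1 mp1).
  by rewrite FA1.
have dA := der A B defG mpAB FA; have dB := der B A defGr mpBA FB.
split=> //; set C := 'C_G(N); have nsC : C <| G.
  by rewrite /normal subsetIl normsI ?normG ?norms_cent.
have nCG := normal_norm nsC; have nCA := subset_trans sAG nCG; have nCB := subset_trans sBG nCG.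
pose pi : nat_pred := [pred q | q <= p].
have leqpi : pi.-group (G / C).
  have leqpi1 (A1 B1 : {group gT}) : A1 * B1 = G -> mutually_permutable A1 B1 ->
      Fstar A1 = A1 -> pi.-group (A1 / C).
    move=> defG1 mp1 FA1; apply/pgroupP=> q prq qdv.
    apply: (minnormal_dvd_leq defG1 mp1 FA1 abN pN prp nsNG).
    by rewrite mem_primes prq cardG_gt0.
  apply: (@pgroup_mulg_quotient _ _ A B C%G) => //; [exact: (leqpi1 A B) | exact: (leqpi1 B A)].
rewrite /pgroup p'natE //; apply/negP=> pG.
have := @abelian_product_pcore _ (A / C)%G (B / C)%G (G / C)%G p.
rewrite (minnormal_pcore_quotient_cent minN pN sNG) eqxx => contr.
suff: false by []; apply: contr => //.
- by rewrite /= -quotientMl ?defG.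
- exact: mutually_permutable_quotient.
- exact: sub_der1_abelian.
- exact: sub_der1_abelian.
move=> q; rewrite mem_primes => /and3P[prq _ qdv].
exact: (pgroupP leqpi).
Qed.

(* n lies in M = AK :&: N for a cyclic p-subgroup K of B, and AK = AM. As p does not divide the order
   of G / C_G(N), both K and M centralize N, so MD = KD for D = C_A(N) and M is cyclic, that is,
   M = <[n]>. *)
Lemma permutes_norm_cycle A B G N (p : nat) :
    A * B = G -> permutes_subgroups A B -> N <| G -> p.-abelem N -> prime p ->
    p^'.-group (G / 'C_G(N)) -> A :&: N = 1 ->
  {in N, forall n, A \subset 'N(<[n]>)}.
Proof.
move=> defG pAB nsNG abelN prp p'GC tiAN n Nn.
have [pN abN _] := and3P abelN; have [sNG nNG] := andP nsNG.
have sAG : A \subset G by rewrite -defG mulG_subl.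
have sBG : B \subset G by rewrite -defG mulG_subr.
have nNA := subset_trans sAG nNG.
have [-> | ntn] := eqVneq n 1; first by rewrite cycle1 norms1.
have sNAB : N \subset A * B by rewrite defG.
have [S [pS sSB sSAN sylT]] := permutes_Sylow nNA tiAN sNAB pAB prp.
have pAS := permutesS sSB pAB.
have defN : (A <*> S) :&: N = N by apply: pHall_id sylT pN.
have : n \in A * S.
  by rewrite -(permutes_joing pAS) // (subsetP _ n Nn) // -defN subsetIl.
case/mulsgP=> a s Aa Ss def_n; have [K defK] : exists K : {group gT}, K = <[s]>%G by exists <[s]>%G.
have sKS : K \subset S by rewrite defK cycle_subG.
have defAK : A <*> K = A * K by rewrite (permutes_joing pAS).
pose M := ((A <*> K) :&: N)%G; have sMN : M \subset N by apply: subsetIr.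
have Mn : n \in M.
  by rewrite in_setI Nn andbT /= defAK def_n mem_mulg // defK cycle_id.
have nMA : A \subset 'N(M).
  by rewrite normsI // (subset_trans (joing_subl A K)) ?normG.
pose C := 'C_G(N)%G; have sKG := subset_trans sKS (subset_trans sSB sBG).
have nCG : G \subset 'N(C) by rewrite normsI ?normG ?norms_cent.
have sKC : K \subset C.
  apply: (@pgroup_sub_p'quotient _ p); first exact: subset_trans nCG.
    exact: pgroupS pS.
  exact: pgroupS (quotientS _ sKG) p'GC.
have sMC : M \subset C.
  by rewrite subsetI (subset_trans sMN) //= (subset_trans sMN).
pose D := (A :&: C)%G; have eqD : D = C :&: A :> {set gT} by rewrite /= setIC.
have sKAN : K \subset A * N by apply: subset_trans sSAN.
have defAM : A * M = A * K.
  rewrite /= setIC group_modl ?joing_subl //= defAK; apply/setIidPr.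
  by rewrite -{2}[gval A]mulGid -mulgA mulgS.
have defDM : (A <*> K) :&: C = D * M.
  by rewrite eqD group_modr // defAM -defAK setIC.
have defDK : (A <*> K) :&: C = D * K.
  by rewrite eqD group_modr // -defAK setIC.
have nDM : M \subset 'N(D).
  rewrite cents_norm // (subset_trans sMN) // centsC.
  by rewrite (subset_trans (subsetIr A C)) ?subsetIr.
have nDK : K \subset 'N(D).
  rewrite (subset_trans (mulG_subr D K)) // -defDK defDM mulG_subG.
  by rewrite normG.
have cycM : cyclic M.
  have tiDM : D :&: M = 1.
    by apply/trivgP; rewrite -tiAN setISS ?subsetIl.
  rewrite (isog_cyclic (quotient_isog nDM tiDM)).
  have defQ : M / D = K / D.
    by rewrite -(quotientMidl D M) -(quotientMidl D K) -defDM defDK.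
  rewrite -[cyclic _]/(cyclic (M / D)) defQ quotient_cyclic //.
  by rewrite defK cycle_cyclic.
have abelM := abelemS sMN abelN.
have on : #[n] = p := abelem_order_p abelN Nn ntn.
have oM : #|M| = p.
  apply: (cyclic_abelem_prime abelM cycM).
  by apply: contraNneq ntn => M1; rewrite -in_set1 -[[set 1]]M1.
have -> : <[n]> = M.
  by apply/eqP; rewrite eqEcard cycle_subG Mn oM -on orderE leqnn.
exact: nMA.
Qed.

End AbelianMinnormal.

Section Quasinilpotent.

Variable gT : finGroupType.
Implicit Types (A B G H K L N P Q X Y : {group gT}).

Lemma quasinilpotent_sub_cent A G N (p : nat) :
    Fstar A = A -> A \subset G -> N <| G -> abelian N -> p.-group N ->
    p^'.-group (G / 'C_G(N)) -> N \subset A ->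
  A \subset 'C(N).
Proof.
move=> FA sAG /andP[sNG nNG] abN pN p'GC sNA; have nNA := subset_trans sAG nNG.
apply: Sylow_sub_gen => q prq; have [P sylP] := Sylow_exists q A; exists P => //.
have sPA := pHall_sub sylP; have qP := pHall_pgroup sylP.
have [eqpq | neqpq] := eqVneq p q.
  have sPG := subset_trans sPA sAG.
  suff: P \subset 'C_G(N) by rewrite subsetI => /andP[].
  apply: (@pgroup_sub_p'quotient _ p); last exact: pgroupS (quotientS _ sPG) p'GC.
    by rewrite normsI ?norms_cent ?(subset_trans sPG) ?normG.
  by rewrite eqpq.
rewrite -(setIidPr sNA); apply: (quasinilpotent_cap_cent FA nNA abN pN) => //.
by apply: pi_pgroup qP _; rewrite !inE eq_sym.
Qed.

(* With R = O_p'(F(A)), the normal p-subgroup BR :&: N of BR lies in B as |BR : B| is prime to p;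
   so R normalizes B :&: N, and A = R C_A(N). *)
Lemma quasinilpotent_cap_normal A B G N (p : nat) :
    A * B = G -> mutually_permutable A B -> Fstar A = A ->
    minnormal N G -> N \subset G -> abelian N -> p.-group N -> prime p ->
    p^'.-group (G / 'C_G(N)) ->
  B :&: N <| G.
Proof.
move=> defG [pAB pBA] FA minN sNG abN pN prp p'GC.
have /andP[ntN nNG] := mingroupp minN.
have sAG : A \subset G by rewrite -defG mulG_subl.
have sBG : B \subset G by rewrite -defG mulG_subr.
pose R := 'O_p^'('F(A))%G; have sRA : R \subset A by rewrite gFsub_trans ?Fitting_sub.
have defBR : B <*> R = B * R by rewrite (permutes_joing pBA).
have sBR : B <*> R \subset G by rewrite join_subG sBG (subset_trans sRA).
pose V := ((B <*> R) :&: N)%G.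
have nVBR : B <*> R \subset 'N(V) by rewrite normsI ?normG // (subset_trans sBR).
have pV : p.-group V by apply: pgroupS pN; apply: subsetIr.
have sVB : V \subset B.
  have nVB := subset_trans (joing_subl B R) nVBR.
  have sVBR : V <*> B \subset B <*> R by rewrite join_subG subsetIl joing_subl.
  have ind1 : #|V <*> B : B| = #|V : B|.
    by apply/eqP; rewrite -(eqn_pmul2r (cardG_gt0 B)) mulnC Lagrange ?joing_subr // LagrangeMr /= norm_joinEr.
  have ind2 : #|B <*> R : B| = #|R : B|.
    by apply/eqP; rewrite -(eqn_pmul2l (cardG_gt0 B)) [X in _ == X]LagrangeMl -defBR Lagrange ?joing_subl.
  rewrite -indexg_eq1; apply/eqP/(@pnat_1 p).
    exact: pnat_dvd (dvdn_indexg V B) pV.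
  rewrite -ind1; apply: (@pnat_dvd _ #|R : B|); last first.
    exact: pnat_dvd (dvdn_indexg R B) (pcore_pgroup _ _).
  by rewrite -ind2 -(Lagrange_index sVBR (joing_subr V B)) dvdn_mull.
have defV : V = B :&: N :> {set gT}.
  by apply/eqP; rewrite eqEsubset subsetI sVB subsetIr setSI ?joing_subl.
have nBR : R \subset 'N(B :&: N) by rewrite -defV (subset_trans (joing_subr B R)).
rewrite /normal (subset_trans (subsetIr B N)) //= -{1}defG mul_subG //; last first.
  by rewrite normsI ?normG // (subset_trans sBG).
have snA' := mutually_permutable_der1_subnormal defG (conj pAB pBA).
have cN (X : {group gT}) : X \subset 'C(N) -> X \subset 'N(B :&: N).
  by move=> cXN; rewrite cents_norm // (subset_trans cXN) ?centS ?subsetIr.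
have [_ defF _ _] := dprodP (nilpotent_pcoreC p (Fitting_nil A)).
have sOA : 'O_p('F(A)) \subset A by rewrite gFsub_trans ?Fitting_sub.
have sOC : 'O_p('F(A)) \subset 'C(N).
  have sOG := subset_trans sOA sAG.
  suff: 'O_p('F(A)) \subset 'C_G(N) by rewrite subsetI => /andP[].
  apply: (@pgroup_sub_p'quotient _ p); last exact: pgroupS (quotientS _ sOG) p'GC.
    by rewrite normsI ?norms_cent ?(subset_trans sOG) ?normG.
  exact: pcore_pgroup.
have sEC : layer A \subset 'C(N).
  rewrite (subset_trans (layer_der1_subnormal snA')) //.
  by rewrite (subset_trans _ (minnormal_cent_Fstar minN sNG abN)) ?joing_subr.
rewrite -FA FstarE -[X in X * _]defF !mul_subG // ?cN //.
Qed.

(** If both factors meet [N] trivially, [G] normalizes every cyclic subgroup of [N]. Otherwise one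
    factor contains [N] and centralizes it, so [G / C] is an image of the other factor, whose
    derived subgroup lies in [C]. *)
Lemma abelian_minnormal_der1 A B G N :
    A * B = G -> mutually_permutable A B -> Fstar A = A -> Fstar B = B ->
    minnormal N G -> N \subset G -> abelian N ->
  G^`(1) \subset 'C(N).
Proof.
move=> defG mpAB FA FB minN sNG abN.
have defGr := mutually_permutable_mulgC defG mpAB.
have mpBA := mutually_permutable_sym mpAB.
have /andP[ntN nNG] := mingroupp minN; have nsNG : N <| G by apply/andP.
have sAG : A \subset G by rewrite -defG mulG_subl.
have sBG : B \subset G by rewrite -defG mulG_subr.
have /is_abelemP[p prp abelN] : is_abelem N.
  exact: charsimple_solvable (minnormal_charsimple minN) (abelian_sol abN).
have pN := abelem_pgroup abelN.
have [dA dB p'GC] := minnormal_p'quotient defG mpAB FA FB minN sNG abN pN prp.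
pose C := 'C_G(N)%G; have nsC : C <| G by rewrite /normal subsetIl normsI ?normG ?norms_cent.
have nCG := normal_norm nsC.
have central (A1 B1 : {group gT}) : A1 * B1 = G -> A1 \subset 'C(N) -> B1^`(1) \subset C ->
    G^`(1) \subset 'C(N).
  move=> defG1 cA1 dB1; have sA1G : A1 \subset G by rewrite -defG1 mulG_subl.
  suff: G^`(1) \subset C by rewrite subsetI => /andP[].
  rewrite der1_min //; have -> : G / C = B1 / C.
    rewrite -defG1 quotientMl ?(subset_trans sA1G) // [A1 / C]quotientS1 ?mul1g //.
    by rewrite subsetI sA1G.
  exact: sub_der1_abelian.
have [[tA tB]|defN] := mutually_permutable_capN_minnormal defG mpAB minN sNG.
  have nA := permutes_norm_cycle defG mpAB.1 nsNG abelN prp p'GC tA.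
  have nB := permutes_norm_cycle defGr mpBA.1 nsNG abelN prp p'GC tB.
  rewrite centsC; apply/subsetP=> n Nn; rewrite -cycle_subG centsC.
  apply: der1_norm_cyclic; last exact: cycle_cyclic.
  by rewrite -defG mul_subG ?nA ?nB.
have nsB0 := quasinilpotent_cap_normal defG mpAB FA minN sNG abN pN prp p'GC.
have [B01|ntB0] := eqVneq (B :&: N) 1.
  have sNA : N \subset A by rewrite -defN B01 mulg1 subsetIl.
  apply: (central A B) => //.
  exact: quasinilpotent_sub_cent FA sAG nsNG abN pN p'GC sNA.
have eqB0 : B :&: N = N.
  have [_ minNG] := mingroupP minN.
  by apply: minNG; rewrite ?subsetIr // ntB0 normal_norm.
apply: (central B A) => //.
apply: (quasinilpotent_sub_cent FB sBG nsNG abN pN p'GC).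
by rewrite -eqB0 subsetIl.
Qed.

End Quasinilpotent.

Lemma quotient_Fstar_full (gT : finGroupType) (A K : {group gT}) :
  A \subset 'N(K) -> Fstar A = A -> Fstar (A / K) = A / K.
Proof. by move=> nKA FA; rewrite -Fseries1 Fseries_full_quotient ?Fseries1. Qed.

Theorem quasinilpotent_product_abelian (gT : finGroupType) (A B G : {group gT}) :
    A * B = G -> mutually_permutable A B -> Fstar A = A -> Fstar B = B ->
  G^`(1) \subset Fstar G.
Proof.
move=> defG mpAB FA FB.
have defGr := mutually_permutable_mulgC defG mpAB.
have mpBA := mutually_permutable_sym mpAB.
have sAG : A \subset G by rewrite -defG mulG_subl.
have sBG : B \subset G by rewrite -defG mulG_subr.
have snA' := mutually_permutable_der1_subnormal defG mpAB.
have snB' := mutually_permutable_der1_subnormal defGr mpBA.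
have nFG : G \subset 'N(Fstar G) := gFnorm _ G.
pose E := layer G; pose Y := (layer G <*> G^`(1))%G; pose X := 'C_Y(layer G)%G.
have sYG : Y \subset G by rewrite join_subG layer_sub der_sub.
have sXY : X \subset Y by apply: subsetIl.
have sXG := subset_trans sXY sYG.
have nsYG : Y <| G by rewrite normalY ?layer_normal ?der_normal.
have nsXG : X <| G.
  by rewrite /normal sXG normsI ?(normal_norm nsYG) // norms_cent ?layer_norm.
have sYEX : Y \subset layer G * X.
  have sYC : Y \subset layer G * 'C_G(layer G).
    rewrite -norm_joinEr; last by rewrite cents_norm ?subsetIr.
    rewrite join_subG joing_subl; exact: layer_cent_der1 defG mpAB FA FB.
  have -> : X = 'C_G(layer G) :&: Y :> {set gT}.
    by rewrite setIAC (setIidPr sYG).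
  by rewrite group_modl ?joing_subl // subsetI sYC subxx.
suff sXF : X \subset 'F(G).
  apply: subset_trans (joing_subr (layer G) _) (subset_trans sYEX _).
  rewrite FstarE (_ : 'F(G) * layer G = layer G * 'F(G)) ?mulgS //.
  by apply: normC; rewrite cents_norm ?Fitting_cent_layer.
have solGF : solvable (G / Fstar G).
  apply: (@mulg_abelian_solvable _ (A / Fstar G)%G (B / Fstar G)%G).
  - by rewrite /= -quotientMl ?defG // (subset_trans sAG).
  - by rewrite sub_der1_abelian // derg1 -{1}FA Fstar_comm_sub.
  by rewrite sub_der1_abelian // derg1 -{1}FB Fstar_comm_sub.
have solX : solvable X.
  have nFX := subset_trans sXG nFG.
  have nsXF : Fstar G :&: X <| X by rewrite /normal subsetIr normsI ?normG.
  rewrite (series_sol nsXF); apply/andP; split.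
    apply: solvableS (nilpotent_sol (Fitting_nil G)).
    apply: subset_trans (cent_layer_Fstar G); rewrite subsetI subsetIl /=.
    by rewrite (subset_trans (subsetIr _ _)) ?subsetIr.
  rewrite (isog_sol (second_isog nFX)).
  exact: solvableS (quotientS _ sXG) solGF.
(* Nilpotency is by definition the absence of a nontrivial [H] inside [[~: H, X]]. Its normal
   closure [L] has the same property, contradicted below on a chief factor [L / V]. *)
rewrite Fitting_max //; apply/forall_inP=> H; rewrite subsetI => /andP[sHX sHHX].
apply: contraT => ntH; pose L := <<class_support H G>>%G.
have sHL : H \subset L.
  by rewrite sub_gen // class_supportEr (bigcup_max 1) ?group1 // conjsg1.
have sHG := subset_trans sHX sXG.
have nsLG : L <| G.
  by rewrite /normal gen_subG class_support_subG ?norms_gen ?class_support_norm.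
have [sLG nLG] := andP nsLG; have nXG := normal_norm nsXG.
have sLX : L \subset X.
  by rewrite gen_subG class_support_sub_norm.
have sLLX : L \subset [~: L, X].
  rewrite gen_subG class_support_sub_norm ?normsR //.
  by rewrite (subset_trans sHHX) // commSg.
have ntL : L :!=: 1 by apply: contraNneq ntH => L1; rewrite -subG1 -L1.
have [V maxV] : {V : {group gT} | maxnormal V L G}.
  by apply: ex_maxgroup; exists 1%G; rewrite proper1G ntL norms1.
have /andP[prV nVG] := maxgroupp maxV; have sVL := proper_sub prV.
have sLV : L \subset V; last by rewrite properE sLV andbF in prV.
have nVL := subset_trans sLG nVG.
have minLV : minnormal (L / V) (G / V) by apply: maxnormal_minnormal.
have abLV : abelian (L / V).
  have solLV : solvable (L / V) by rewrite quotient_sol // (solvableS sLX).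
  have := charsimple_solvable (minnormal_charsimple minLV) solLV.
  by case/is_abelemP=> p _ /abelem_abelian.
have nVA := subset_trans sAG nVG; have nVB := subset_trans sBG nVG.
have cG'L : (G / V)^`(1) \subset 'C(L / V).
  apply: (@abelian_minnormal_der1 _ (A / V)%G (B / V)%G (G / V)%G (L / V)%G) => //.
  - by rewrite /= -quotientMl ?defG.
  - exact: mutually_permutable_quotient.
  - exact: quotient_Fstar_full.
  - exact: quotient_Fstar_full.
  exact: quotientS.
apply: subset_trans sLLX (subset_trans (commgS _ sXY) _).
have nVY := subset_trans sYG nVG.
rewrite -quotient_cents2 // centsC quotientY ?(subset_trans (layer_sub G)) ?(subset_trans (der_sub 1 G)) //.
rewrite join_subG quotient_der // cG'L andbT quotient_cents // centsC.
by rewrite (subset_trans sLX) // subsetIr.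
Qed.

(** * Bounds on the height *)

Lemma Fseries_cap_sub (gT : finGroupType) (A B G : {group gT}) n :
  A * B = G -> mutually_permutable A B -> A :&: Fseries n G \subset Fseries n A.
Proof.
move=> defG mpAB; have sAG : A \subset G by rewrite -defG mulG_subl.
have sBG : B \subset G by rewrite -defG mulG_subr.
elim: n => [|n IHn]; first by rewrite !Fseries0 subsetIr.
have nSG := Fseries_norm n G; have nRA := Fseries_norm n A.
have nSA := subset_trans sAG nSG; have nSB := subset_trans sBG nSG.
apply/subsetP=> x /setIP[Ax]; have Gx := subsetP sAG x Ax.
rewrite !mem_FseriesS // => Fx.
(* The induction hypothesis is exactly what makes [A / Fseries n A] an image of
   [A / Fseries n G]. *)
apply: (Fstar_quotient_factor nSA nRA IHn Ax).
have mpQ := mutually_permutable_quotient nSA nSB mpAB.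
have defQ : (A / Fseries n G)%G * (B / Fseries n G)%G = (G / Fseries n G)%G.
  by rewrite /= -quotientMl ?defG.
have sAQ := quotientS (Fseries n G) sAG.
have := cap_Fstar_sub sAQ (mutually_permutable_der1_subnormal defQ mpQ).
by move/subsetP; apply; rewrite inE mem_quotient.
Qed.

Lemma Fseries_full_factor (gT : finGroupType) (A B G : {group gT}) n :
  A * B = G -> mutually_permutable A B -> Fseries n G = G -> Fseries n A = A.
Proof.
move=> defG mpAB fullG; have sAG : A \subset G by rewrite -defG mulG_subl.
have := Fseries_cap_sub n defG mpAB; rewrite fullG (setIidPl sAG) => sAF.
by apply/eqP; rewrite eqEsubset Fseries_sub.
Qed.

(* The image of F*(A) in G / F*(G) is central in the image of A, so for n >= 1 it does not
   contribute to the height. *)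
Lemma Fseries_full_quotient_Fstar (gT : finGroupType) (A G : {group gT}) n :
    A \subset G -> A^`(1) <|<| G -> Fseries n.+2 A = A ->
  Fseries n.+1 (A / Fstar G) = A / Fstar G.
Proof.
move=> sAG snA' fullA; have nFA : A \subset 'N(Fstar G) := subset_trans sAG (gFnorm _ _).
have nFAA : A \subset 'N(Fstar A) := gFnorm _ A.
pose Z := (Fstar A / Fstar G)%G.
have sFA := Fstar_sub A.
have sZ : Z \subset 'Z(A / Fstar G).
  rewrite subsetI quotientS //= quotient_cents2r //.
  exact: Fstar_comm_sub.
apply: (Fseries_full_central sZ).
have fullAF := Fseries_full_quo fullA.
have nZA : A / Fstar G \subset 'N(Z) by rewrite quotient_norms.
have sAg : A \subset 'dom (coset Z \o coset (Fstar G)).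
  by rewrite /= -sub_morphim_pre.
pose f := [morphism of restrm sAg (coset Z \o coset (Fstar G))].
have imf : f @* A = A / Fstar G / Z.
  by rewrite /= morphim_restrm setIid morphim_comp.
pose q := [morphism of restrm nFAA (coset (Fstar A))].
have imq : q @* A = A / Fstar A by rewrite /= morphim_restrm setIid.
have kqf : 'ker q \subset 'ker f.
  rewrite /= !ker_restrm ker_comp !ker_coset setISS //.
  by rewrite -sub_morphim_pre // (subset_trans sFA).
have fullq : Fseries n.+1 (q @* A) = q @* A by rewrite imq.
have := Fseries_full_morphim [morphism of factm kqf (subxx A)] fullq.
by rewrite /= morphim_factm [_ @* A]imf.
Qed.

Lemma Fseries_full_product n (gT : finGroupType) (A B G : {group gT}) :
    A * B = G -> mutually_permutable A B ->
    Fseries n.+1 A = A -> Fseries n.+1 B = B ->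
  Fseries n.+2 G = G.
Proof.
elim: n gT A B G => [|n IHn] gT A B G defG mpAB fullA fullB; apply: Fseries_full_quoS.
  rewrite !Fseries1 in fullA fullB *.
  apply: nilpotent_Fstar; apply/abelian_nil/sub_der1_abelian.
  exact: quasinilpotent_product_abelian defG mpAB fullA fullB.
have defGr := mutually_permutable_mulgC defG mpAB.
have sAG : A \subset G by rewrite -defG mulG_subl.
have sBG : B \subset G by rewrite -defG mulG_subr.
have nFG : G \subset 'N(Fstar G) := gFnorm _ G.
have nFA := subset_trans sAG nFG; have nFB := subset_trans sBG nFG.
apply: (IHn _ (A / Fstar G)%G (B / Fstar G)%G).
- by rewrite /= -quotientMl ?defG.
- exact: mutually_permutable_quotient.
- apply: (Fseries_full_quotient_Fstar sAG) => //.
  exact: mutually_permutable_der1_subnormal defG mpAB.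
apply: (Fseries_full_quotient_Fstar sBG) => //.
exact: mutually_permutable_der1_subnormal defGr (mutually_permutable_sym mpAB).
Qed.

Theorem theorem7 (gT : finGroupType) (G A B : {group gT}) :
  (A * B)%g = G -> mutually_permutable A B ->
  maxn (hstar A) (hstar B) <= hstar G <= (maxn (hstar A) (hstar B)).+1.
Proof.
move=> defG mpAB; have defGr := mutually_permutable_mulgC defG mpAB.
have mpBA := mutually_permutable_sym mpAB.
rewrite geq_max; apply/andP; split.
  apply/andP; split; apply: hstar_leq.
    exact: Fseries_full_factor defG mpAB (hstar_full G).
  exact: Fseries_full_factor defGr mpBA (hstar_full G).
set h := maxn _ _; apply: hstar_leq.
have fullA : Fseries h A = A by apply: Fseries_full_leq (hstar_full A); apply: leq_maxl.
have fullB : Fseries h B = B by apply: Fseries_full_leq (hstar_full B); apply: leq_maxr.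
(* [Fseries_full_product] starts at height one; at height zero both factors are trivial, and so is
   [G]. *)
case: h fullA fullB => [A1 B1|h]; last exact: Fseries_full_product.
apply/eqP; rewrite eqEsubset Fseries_sub -{1}defG -A1 -B1 !Fseries0 mulg1.
exact: sub1G.
Qed.
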